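(* Let $n\ge2$ and let $\widehat{\mathcal N}_n=\widehat{\mathcal N}_{n,F}(\Omega)$ be the degenerate affine BMW algebra over an algebraically closed field $F$ (of arbitrary characteristic), with parameters $\Omega=(\omega_a)_{a\ge0}$. Suppose that $e_1\ne0$ in $\widehat{\mathcal N}_n$. The following are equivalent: (1) The generating function $\sum_{a\ge0}\omega_at^{-a}$ is a rational function in $F(t)$. (2) $\Omega$ satisfies a linear homogeneous recursion; i.e. there exist $r>0$, $N\ge0$ and $a_0,\dots,a_{r-1}\in F$ such that $\omega_{r+\ell}+\sum_{j=0}^{r-1}a_j\omega_{j+\ell}=0$ for all $\ell\ge N$. (3) There exist $r>0$ and $a_0,\dots,a_{r-1}\in F$ such that $\omega_{r+\ell}+\sum_{j=0}^{r-1}a_j\omega_{j+\ell}=0$ for all $\ell\ge0$. (4) There exist $r>0$ and $u_1,\dots,u_r\in F$ such that the parameters $\Omega$ and $u_1,\dots,u_r$ are admissible. (5) $\widehat{\mathcal N}_n$ admits a finite dimensional module on which $e_1$ is non-zero.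
   Context: Let $n\ge1$, $S$ a commutative ring with $1$, $\Omega=(\omega_a)_{a\ge0}$ a sequence in $S$. The degenerate affine BMW algebra $\widehat{\mathcal N}_{n,S}(\Omega)$ is the unital associative $S$-algebra with generators $s_i,e_i$ ($1\le i<n$), $y_j$ ($1\le j\le n$) and relations (for all indices for which they make sense): (1) $s_i^2=1$; (2) $s_is_j=s_js_i$ if $|i-j|>1$, $s_is_{i+1}s_i=s_{i+1}s_is_{i+1}$, $s_iy_j=y_js_i$ if $j\ne i,i+1$; (3) $e_i^2=\omega_0e_i$; (4) $e_1y_1^ae_1=\omega_ae_1$ for $a>0$; (5) $s_ie_j=e_js_i$ and $e_ie_j=e_je_i$ if $|i-j|>1$, $e_iy_j=y_je_i$ if $j\ne i,i+1$, $y_iy_j=y_jy_i$; (6) $e_is_i=e_i=s_ie_i$, $s_ie_{i+1}e_i=s_{i+1}e_i$, $e_ie_{i+1}s_i=e_is_{i+1}$, $e_{i+1}e_is_{i+1}=e_{i+1}s_i$, $s_{i+1}e_ie_{i+1}=s_ie_{i+1}$, $e_{i+1}e_ie_{i+1}=e_{i+1}$, $e_ie_{i+1}e_i=e_i$; (7) $s_iy_i-y_{i+1}s_i=e_i-1$, $y_is_i-s_iy_{i+1}=e_i-1$; (8) $e_i(y_i+y_{i+1})=0=(y_i+y_{i+1})e_i$. For $r\ge1$ and $u_1,\dots,u_r\in S$, the degenerate cyclotomic BMW algebra $\mathcal N_{n,S,r}(\Omega;u_1,\dots,u_r)$ is the quotient of $\widehat{\mathcal N}_{n,S}(\Omega)$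 by the relation $(y_1-u_1)\cdots(y_1-u_r)=0$. The parameters $\Omega,u_1,\dots,u_r$ are admissible if $\{e_1,y_1e_1,\dots,y_1^{r-1}e_1\}$ is linearly independent over $F$ in $\mathcal N_{2,F,r}(\Omega;u_1,\dots,u_r)$. A formal series in $t^{-1}$ ''is a rational function'' if it lies in the image of $F(t)$ in $F((t^{-1}))$. *)

(* Defs.v *)
From HB Require Import structures.
From mathcomp Require Import all_boot all_algebra.
From mathcomp Require Import boolp monalg.

Set Implicit Arguments.
Unset Strict Implicit.
Unset Printing Implicit Defensive.

Import GRing.Theory.
Local Open Scope ring_scope.
Local Open Scope quotient_scope.

(* The free unital associative algebra S<X>: the monoid algebra over S of the *)
(* monoid of words in X.                                                      *)
Definition freeAlg (S : comNzRingType) (X : choiceType) : Type :=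
  {malg S[{fmonom X}]}.
HB.instance Definition _ (S : comNzRingType) (X : choiceType) :=
  GRing.Lalgebra.on (freeAlg S X).

Lemma freeAlg_scalerAr (S : comNzRingType) (X : choiceType) (c : S)
  (f g : freeAlg S X) : c *: (f * g) = f * (c *: g).
Proof.
have comm_c : c%:MP * f = f * c%:MP :> {malg S[{fmonom X}]}.
  rewrite !malgM_def fgmulUg fgmulgU; apply: eq_bigr => k _.
  by rewrite mulrC mul1m mulm1.
by rewrite -[c *: _]mul_malgC mulrA comm_c -mulrA mul_malgC.
Qed.
HB.instance Definition _ (S : comNzRingType) (X : choiceType) :=
  GRing.Lalgebra_isAlgebra.Build S (freeAlg S X) (@freeAlg_scalerAr S X).

Definition freeGen (S : comNzRingType) (X : choiceType) (x : X) : freeAlg S X :=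
  << fmu x >>.

Section PresentedAlgebra.
Variables (S : comNzRingType) (X : choiceType).
Local Notation A := (freeAlg S X).

(* The two-sided ideal generated by the elements l - r with rel l r. *)
Inductive in_ideal (rel : A -> A -> Prop) : A -> Prop :=
| in_ideal0 : in_ideal rel 0
| in_idealD a l r b z : rel l r -> in_ideal rel z ->
    in_ideal rel (a * (l - r) * b + z).

Variable rel : A -> A -> Prop.

Definition rel_ideal : {pred A} := fun z => `[< in_ideal rel z >].

Lemma rel_idealP z : reflect (in_ideal rel z) (z \in rel_ideal).
Proof. exact: asboolP. Qed.

Lemma in_ideal_add x y : in_ideal rel x -> in_ideal rel y -> in_ideal rel (x + y).
Proof.
elim=> [|a l r b z lr _ IH] Iy; first by rewrite add0r.
by rewrite -addrA; apply: in_idealD => //; exact: IH.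
Qed.

Lemma in_idealMl c x : in_ideal rel x -> in_ideal rel (c * x).
Proof.
elim=> [|a l r b z lr _ IH]; first by rewrite mulr0; constructor.
by rewrite mulrDr !mulrA -(mulrA _ (l - r)) mulrA; constructor.
Qed.

Lemma in_idealMr c x : in_ideal rel x -> in_ideal rel (x * c).
Proof.
elim=> [|a l r b z lr _ IH]; first by rewrite mul0r; constructor.
by rewrite mulrDl -mulrA; constructor.
Qed.

Lemma rel_ideal_zmod : zmod_closed rel_ideal.
Proof.
split=> [|x y /rel_idealP Ix /rel_idealP Iy]; apply/rel_idealP.
  by constructor.
by apply: in_ideal_add => //; rewrite -mulN1r; exact: in_idealMl.
Qed.
HB.instance Definition _ := GRing.isZmodClosed.Build A rel_ideal rel_ideal_zmod.

(* The quotient of the free algebra by this ideal.  It could a priori be the  *)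
(* zero ring, whence a pzRingType; it is also an lmodType S, and lemmas       *)
(* presAlg_scalerAl and presAlg_scalerAr say that it is an S-algebra.         *)
Definition presAlg : Type := @Quotient.quot A rel_ideal.
HB.instance Definition _ := GRing.Zmodule.on presAlg.
HB.instance Definition _ := EqQuotient.on presAlg.

Definition presPi (x : A) : presAlg := \pi_presAlg x.
Definition presGen (x : X) : presAlg := presPi (freeGen S x).

Lemma presPi_eq x y : presPi x = presPi y <-> in_ideal rel (x - y).
Proof.
split=> [xy|xy]; first by apply/rel_idealP; rewrite Quotient.idealrBE; apply/eqP.
by apply/eqP; rewrite -[_ == _]Quotient.idealrBE; apply/rel_idealP.
Qed.

Lemma presPi_rel x y : rel x y -> presPi x = presPi y.
Proof.
move=> xy; apply/presPi_eq; rewrite -[x - y]mul1r -[1 * _]mulr1 -[_ * 1]addr0.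
by constructor; last constructor.
Qed.

Lemma presPi_repr (x : presAlg) : presPi (repr x) = x.
Proof. exact: reprK. Qed.

Lemma presPiD x y : presPi (x + y) = presPi x + presPi y.
Proof. exact: (@Quotient.pi_add A rel_ideal). Qed.

Definition pres1 : presAlg := presPi 1.
Definition presM (x y : presAlg) : presAlg := presPi (repr x * repr y).
Definition presZ (c : S) (x : presAlg) : presAlg := presPi (c *: repr x).

Lemma presPi_M x y : presPi (x * y) = presM (presPi x) (presPi y).
Proof.
have Ir z : in_ideal rel (z - repr (presPi z)).
  by apply/presPi_eq; rewrite presPi_repr.
apply/presPi_eq; set x' := repr _; set y' := repr _.
have -> : x * y - x' * y' = (x - x') * y + x' * (y - y').
  by rewrite mulrBl mulrBr addrA subrK.
by apply: in_ideal_add; [exact: in_idealMr | exact: in_idealMl].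
Qed.

Lemma presPi_Z c x : presPi (c *: x) = presZ c (presPi x).
Proof.
apply/presPi_eq; rewrite -scalerBr -[_ - _]mul1r scalerAl.
by apply: in_idealMl; apply/presPi_eq; rewrite presPi_repr.
Qed.

Lemma presMA : associative presM.
Proof.
move=> x y z; rewrite -(presPi_repr x) -(presPi_repr y) -(presPi_repr z).
by rewrite -!presPi_M mulrA.
Qed.
Lemma pres1M : left_id pres1 presM.
Proof. by move=> x; rewrite -(presPi_repr x) -presPi_M mul1r. Qed.
Lemma presM1 : right_id pres1 presM.
Proof. by move=> x; rewrite -(presPi_repr x) -presPi_M mulr1. Qed.
Lemma presMDl : left_distributive presM +%R.
Proof.
move=> x y z; rewrite -(presPi_repr x) -(presPi_repr y) -(presPi_repr z).
by rewrite -presPiD -!presPi_M mulrDl presPiD.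
Qed.
Lemma presMDr : right_distributive presM +%R.
Proof.
move=> x y z; rewrite -(presPi_repr x) -(presPi_repr y) -(presPi_repr z).
by rewrite -presPiD -!presPi_M mulrDr presPiD.
Qed.
HB.instance Definition _ := GRing.Zmodule_isPzRing.Build presAlg
  presMA pres1M presM1 presMDl presMDr.

Lemma presZA a b x : presZ a (presZ b x) = presZ (a * b) x.
Proof. by rewrite -(presPi_repr x) -!presPi_Z scalerA. Qed.
Lemma pres1Z : left_id 1 presZ.
Proof. by move=> x; rewrite -(presPi_repr x) -presPi_Z scale1r. Qed.
Lemma presZDr : right_distributive presZ +%R.
Proof.
move=> c x y; rewrite -(presPi_repr x) -(presPi_repr y).
by rewrite -presPiD -!presPi_Z scalerDr presPiD.
Qed.
Lemma presZDl x : {morph presZ^~ x : a b / a + b}.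
Proof.
by move=> a b; rewrite -(presPi_repr x) -!presPi_Z scalerDl presPiD.
Qed.
HB.instance Definition _ := GRing.Zmodule_isLmodule.Build S presAlg
  presZA pres1Z presZDr presZDl.

Lemma presAlg_scalerAl c (x y : presAlg) : c *: (x * y) = c *: x * y.
Proof.
rewrite -(presPi_repr x) -(presPi_repr y) -[_ * _]presPi_M -[c *: _]presPi_Z.
by rewrite scalerAl presPi_M presPi_Z.
Qed.

Lemma presAlg_scalerAr c (x y : presAlg) : c *: (x * y) = x * (c *: y).
Proof.
rewrite -(presPi_repr x) -(presPi_repr y) -[_ * _]presPi_M -[c *: _]presPi_Z.
by rewrite scalerAr presPi_M presPi_Z.
Qed.

Record is_module (V : lmodType S) (act : presAlg -> V -> V) : Prop := {
  act_linear_l : forall v, linear (act^~ v);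
  act_linear_r : forall a, linear (act a);
  act_one : forall v, act 1 v = v;
  act_mul : forall a b v, act (a * b) v = act a (act b v)
}.

End PresentedAlgebra.

(* Indices are shifted by one: the generators s_{i+1}, e_{i+1} are indexed by *)
(* i : 'I_n.-1 and y_{j+1} by j : 'I_n.                                       *)
Definition bmwIndex (n : nat) : choiceType := ('I_n.-1 + 'I_n.-1 + 'I_n)%type.

Section BMW.
Variables (n : nat) (S : comNzRingType) (omega : nat -> S).
Local Notation A := (freeAlg S (bmwIndex n)).

Local Notation s i := (freeGen S (inl (inl i) : bmwIndex n)).
Local Notation e i := (freeGen S (inl (inr i) : bmwIndex n)).
Local Notation y j := (freeGen S (inr j : bmwIndex n)).

Definition distant (i j : nat) : bool := (i.+1 < j)%N || (j.+1 < i)%N.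

Inductive affBMW_rel : A -> A -> Prop :=
| rel_ss (i : 'I_n.-1) : affBMW_rel (s i * s i) 1
| rel_ss_comm (i j : 'I_n.-1) : distant i j -> affBMW_rel (s i * s j) (s j * s i)
| rel_braid (i j : 'I_n.-1) : j = i.+1 :> nat ->
    affBMW_rel (s i * s j * s i) (s j * s i * s j)
| rel_sy_comm (i : 'I_n.-1) (j : 'I_n) :
    j <> i :> nat -> j <> i.+1 :> nat -> affBMW_rel (s i * y j) (y j * s i)
| rel_ee (i : 'I_n.-1) : affBMW_rel (e i * e i) (omega 0%N *: e i)
| rel_eye (i : 'I_n.-1) (j : 'I_n) (a : nat) :
    i = 0%N :> nat -> j = 0%N :> nat -> (0 < a)%N ->
    affBMW_rel (e i * y j ^+ a * e i) (omega a *: e i)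
| rel_se_comm (i j : 'I_n.-1) : distant i j -> affBMW_rel (s i * e j) (e j * s i)
| rel_ee_comm (i j : 'I_n.-1) : distant i j -> affBMW_rel (e i * e j) (e j * e i)
| rel_ey_comm (i : 'I_n.-1) (j : 'I_n) :
    j <> i :> nat -> j <> i.+1 :> nat -> affBMW_rel (e i * y j) (y j * e i)
| rel_yy_comm (i j : 'I_n) : affBMW_rel (y i * y j) (y j * y i)
| rel_es (i : 'I_n.-1) : affBMW_rel (e i * s i) (e i)
| rel_se (i : 'I_n.-1) : affBMW_rel (s i * e i) (e i)
| rel_see (i j : 'I_n.-1) : j = i.+1 :> nat ->
    affBMW_rel (s i * e j * e i) (s j * e i)
| rel_ees (i j : 'I_n.-1) : j = i.+1 :> nat ->
    affBMW_rel (e i * e j * s i) (e i * s j)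
| rel_ees' (i j : 'I_n.-1) : j = i.+1 :> nat ->
    affBMW_rel (e j * e i * s j) (e j * s i)
| rel_see' (i j : 'I_n.-1) : j = i.+1 :> nat ->
    affBMW_rel (s j * e i * e j) (s i * e j)
| rel_eee (i j : 'I_n.-1) : j = i.+1 :> nat ->
    affBMW_rel (e j * e i * e j) (e j)
| rel_eee' (i j : 'I_n.-1) : j = i.+1 :> nat ->
    affBMW_rel (e i * e j * e i) (e i)
| rel_sy (i : 'I_n.-1) (j k : 'I_n) : j = i :> nat -> k = i.+1 :> nat ->
    affBMW_rel (s i * y j - y k * s i) (e i - 1)
| rel_ys (i : 'I_n.-1) (j k : 'I_n) : j = i :> nat -> k = i.+1 :> nat ->
    affBMW_rel (y j * s i - s i * y k) (e i - 1)
| rel_eyy (i : 'I_n.-1) (j k : 'I_n) : j = i :> nat -> k = i.+1 :> nat ->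
    affBMW_rel (e i * (y j + y k)) 0
| rel_yye (i : 'I_n.-1) (j k : 'I_n) : j = i :> nat -> k = i.+1 :> nat ->
    affBMW_rel ((y j + y k) * e i) 0.

Inductive cycBMW_rel (r : nat) (u : r.-tuple S) : A -> A -> Prop :=
| rel_aff x1 x2 : affBMW_rel x1 x2 -> cycBMW_rel u x1 x2
| rel_cyc (j : 'I_n) : j = 0%N :> nat ->
    cycBMW_rel u (\prod_(i < r) (y j - (tnth u i)%:A)) 0.

Definition affBMW := presAlg affBMW_rel.
Definition cycBMW (r : nat) (u : r.-tuple S) := presAlg (cycBMW_rel u).

End BMW.

HB.instance Definition _ n (S : comNzRingType) (omega : nat -> S) :=
  GRing.PzRing.on (affBMW n omega).
HB.instance Definition _ n (S : comNzRingType) (omega : nat -> S) :=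
  GRing.Lmodule.on (affBMW n omega).
HB.instance Definition _ n (S : comNzRingType) (omega : nat -> S) r
  (u : r.-tuple S) := GRing.PzRing.on (cycBMW n omega u).
HB.instance Definition _ n (S : comNzRingType) (omega : nat -> S) r
  (u : r.-tuple S) := GRing.Lmodule.on (cycBMW n omega u).

Lemma idx1_subproof n : (1 < n)%N -> (0 < n.-1)%N.
Proof. by case: n => [|[]]. Qed.

Definition idx1 n (n_gt1 : (1 < n)%N) : 'I_n.-1 := Ordinal (idx1_subproof n_gt1).

Definition aff_e1 n (n_gt1 : (1 < n)%N) (S : comNzRingType) (omega : nat -> S) :
  affBMW n omega := presGen _ (inl (inr (idx1 n_gt1)) : bmwIndex n).

Definition cyc2_e1 (S : comNzRingType) (omega : nat -> S) r (u : r.-tuple S) :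
  cycBMW 2 omega u := presGen _ (inl (inr (ord0 : 'I_1)) : bmwIndex 2).
Definition cyc2_y1 (S : comNzRingType) (omega : nat -> S) r (u : r.-tuple S) :
  cycBMW 2 omega u := presGen _ (inr (ord0 : 'I_2) : bmwIndex 2).

Definition lin_indep (F : fieldType) (V : lmodType F) r (v : 'I_r -> V) : Prop :=
  forall c : 'I_r -> F, \sum_i c i *: v i = 0 -> forall i, c i = 0.

Definition admissible (F : fieldType) (omega : nat -> F) r (u : r.-tuple F) :=
  lin_indep (fun k : 'I_r => cyc2_y1 omega u ^+ k * cyc2_e1 omega u).

(* F[[t^-1]]; fps_coef f k is the coefficient of t^-k. *)
Record fps (F : fieldType) : Type := Fps { fps_coef : nat -> F }.

Section FPS.
Variable F : fieldType.
Implicit Types f g h : fps F.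

HB.instance Definition _ := gen_eqMixin (fps F).
HB.instance Definition _ := gen_choiceMixin (fps F).

Lemma fpsP f g : fps_coef f =1 fps_coef g <-> f = g.
Proof. by split=> [|->//]; case: f g => f [g] /= /funext ->. Qed.

Definition fps0 : fps F := Fps (fun _ => 0).
Definition fps1 : fps F := Fps (fun k => (k == 0%N)%:R).
Definition fps_opp f : fps F := Fps (fun k => - fps_coef f k).
Definition fps_add f g : fps F := Fps (fun k => fps_coef f k + fps_coef g k).
Definition fps_mul f g : fps F :=
  Fps (fun k => \sum_(i < k.+1) fps_coef f i * fps_coef g (k - i)%N).

Lemma fps_addA : associative fps_add.
Proof. by move=> f g h; apply/fpsP => k /=; rewrite addrA. Qed.
Lemma fps_addC : commutative fps_add.
Proof. by move=> f g; apply/fpsP => k /=; rewrite addrC. Qed.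
Lemma fps_add0 : left_id fps0 fps_add.
Proof. by move=> f; apply/fpsP => k /=; rewrite add0r. Qed.
Lemma fps_addN : left_inverse fps0 fps_opp fps_add.
Proof. by move=> f; apply/fpsP => k /=; rewrite addNr. Qed.
HB.instance Definition _ :=
  GRing.isZmodule.Build (fps F) fps_addA fps_addC fps_add0 fps_addN.

Definition fps_trunc n f : {poly F} := \poly_(i < n.+1) fps_coef f i.

Lemma fps_truncE n f k : (k <= n)%N -> (fps_trunc n f)`_k = fps_coef f k.
Proof. by move=> kn; rewrite coef_poly ltnS kn. Qed.

Lemma fps_truncM n f g k : (k <= n)%N ->
  (fps_trunc n f * fps_trunc n g)`_k = fps_coef (fps_mul f g) k.
Proof.
move=> kn; rewrite coefM; apply: eq_bigr => i _.
by rewrite !fps_truncE // ?(leq_trans (leq_subr _ _)) // (leq_trans _ kn) // -ltnS.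
Qed.

Lemma fps_mulC : commutative fps_mul.
Proof. by move=> f g; apply/fpsP => k; rewrite -!(@fps_truncM k) // mulrC. Qed.
Lemma fps_mulA : associative fps_mul.
Proof.
move=> f g h; apply/fpsP => k; transitivity (fps_trunc k f * fps_trunc k g * fps_trunc k h)`_k.
  rewrite -mulrA coefM; apply: eq_bigr => i _.
  by rewrite fps_truncM ?leq_subr // fps_truncE // -ltnS.
rewrite coefM; apply: eq_bigr => i _.
by rewrite fps_truncM ?fps_truncE ?leq_subr // -ltnS.
Qed.
Lemma fps_mul1 : left_id fps1 fps_mul.
Proof.
move=> f; apply/fpsP => k /=; rewrite big_ord_recl /= mul1r subn0.
by rewrite big1 ?addr0 // => i _; rewrite mul0r.
Qed.
Lemma fps_mulDl : left_distributive fps_mul +%R.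
Proof.
move=> f g h; apply/fpsP => k /=; rewrite -big_split /=.
by apply: eq_bigr => i _; rewrite mulrDl.
Qed.
Lemma fps1_neq0 : fps1 != 0.
Proof. by apply/eqP => /fpsP/(_ 0%N)/eqP; rewrite /= oner_eq0. Qed.
HB.instance Definition _ := GRing.Zmodule_isComNzRing.Build (fps F)
  fps_mulA fps_mulC fps_mul1 fps_mulDl fps1_neq0.

Definition fps_unit : pred (fps F) := fun f => `[< exists g, g * f = 1 >].
Definition fps_inv f : fps F :=
  if pselect (exists g, g * f = 1) is left ex then sval (cid ex) else f.
Lemma fps_mulV : {in fps_unit, left_inverse 1 fps_inv *%R}.
Proof.
move=> f /asboolP uf; rewrite /fps_inv.
by case: pselect => // ex; exact: (svalP (cid ex)).
Qed.
Lemma fps_unitP f g : g * f = 1 -> f \in fps_unit.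
Proof. by move=> gf; apply/asboolP; exists g. Qed.
Lemma fps_inv_out : {in [predC fps_unit], fps_inv =1 id}.
Proof.
move=> f; rewrite inE => /asboolPn uf; rewrite /fps_inv.
by case: pselect.
Qed.
HB.instance Definition _ := GRing.ComNzRing_hasMulInverse.Build (fps F)
  fps_mulV fps_unitP fps_inv_out.

Lemma fps_lowest f : f != 0 ->
  exists2 m, fps_coef f m != 0 & forall i, (i < m)%N -> fps_coef f i = 0.
Proof.
move=> nz; have ex : exists m, fps_coef f m != 0.
  apply: contrapT => /forallNP f0; case/eqP: nz; apply/fpsP => k /=.
  by apply/eqP; have /negP := f0 k; rewrite negbK.
exists (ex_minn ex); first by case: ex_minnP.
case: ex_minnP => m _ min i im; apply/eqP; apply: contraLR im => /min.
by rewrite -leqNgt.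
Qed.

Lemma fps_integral f g : f * g = 0 -> (f == 0) || (g == 0).
Proof.
move=> fg0; apply: contraPT fg0; rewrite negb_or => /andP[].
move=> /fps_lowest[m fm mf] /fps_lowest[k gk mg] /fpsP/(_ (m + k)%N)/eqP /=.
have lt_m : (m < (m + k).+1)%N by rewrite ltnS leq_addr.
rewrite (bigD1 (Ordinal lt_m)) //= addKn big1 ?addr0.
  by rewrite mulf_eq0 (negPf fm) (negPf gk).
move=> i; rewrite -val_eqE /= neq_ltn => /orP[im|mi].
  by rewrite mf ?mul0r.
rewrite (mg (m + k - i)%N) ?mulr0 // ltn_subLR; last by rewrite -ltnS.
by rewrite ltn_add2r.
Qed.
HB.instance Definition _ := GRing.ComUnitRing_isIntegral.Build (fps F) fps_integral.

(* F((t^-1)), as the field of fractions of F[[t^-1]] *)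
Definition laurent : fieldType := {fraction (fps F)}.

Definition fps_tinv : fps F := Fps (fun k => (k == 1%N)%:R).
Definition laurent_t : laurent := (FracField.tofrac fps_tinv)^-1.
Definition fpsC (c : F) : fps F := Fps (fun k => if k == 0%N then c else 0).
Definition laurentC (c : F) : laurent := FracField.tofrac (fpsC c).

Definition laurent_poly (p : {poly F}) : laurent :=
  (map_poly laurentC p).[laurent_t].
(* The embedding F(t) -> F((t^-1)); lemmas laurent_ratX and laurent_ratC and  *)
(* the rmorphism instance below characterize it.                              *)
Definition laurent_rat (x : {fraction {poly F}}) : laurent :=
  laurent_poly \n_(repr x) / laurent_poly \d_(repr x).

Lemma fpsC_zmod : zmod_morphism fpsC.
Proof. by move=> a b; apply/fpsP => -[|k] //=; rewrite subr0. Qed.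
Lemma fpsC_monoid : monoid_morphism fpsC.
Proof.
split=> [|a b]; apply/fpsP => -[|k] //=; first by rewrite big_ord1.
rewrite big1 // => -[i /= _] _; case: i => [|i]; last by rewrite mul0r.
by rewrite subn0 mulr0.
Qed.
HB.instance Definition _ := GRing.isZmodMorphism.Build F (fps F) fpsC fpsC_zmod.
HB.instance Definition _ :=
  GRing.isMonoidMorphism.Build F (fps F) fpsC fpsC_monoid.
HB.instance Definition _ :=
  GRing.RMorphism.copy laurentC (@FracField.tofrac (fps F) \o fpsC).

Lemma laurent_poly_comm : commr_rmorph laurentC laurent_t.
Proof. by move=> c; exact: mulrC. Qed.
HB.instance Definition _ :=
  GRing.RMorphism.copy laurent_poly (horner_morph laurent_poly_comm).

Lemma fps_tinv_neq0 : fps_tinv != 0.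
Proof. by apply/eqP => /fpsP/(_ 1%N)/eqP; rewrite /= oner_eq0. Qed.

Lemma fps_tinvXE k j : fps_coef (fps_tinv ^+ k) j = (j == k)%:R.
Proof.
elim: k j => [|k IH] j //; rewrite exprS /=.
case: j => [|j]; first by rewrite big_ord1 mul0r.
rewrite !big_ord_recl /= mul0r add0r mul1r subn1 IH big1 ?addr0 // => i _.
by rewrite mul0r.
Qed.

Lemma laurent_poly_eq0 p : (laurent_poly p == 0) = (p == 0).
Proof.
apply/idP/idP => [|/eqP->]; last by rewrite rmorph0.
apply: contraLR => p_neq0; pose d := (size p).-1.
have d_lt : (d < size p)%N by rewrite /d prednK // size_poly_gt0.
pose f : fps F := \sum_(i < size p) fpsC p`_i * fps_tinv ^+ (d - i).
have f_neq0 : f != 0.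
  apply/eqP => /(congr1 (fun g => fps_coef g 0)) /=.
  rewrite (@big_morph _ _ (fun g => fps_coef g 0%N) 0 +%R) // => fd0.
  move: fd0; rewrite (bigD1 (Ordinal d_lt)) //= big_ord1 /= subnn mulr1 big1.
    by move/eqP; rewrite addr0 -/(lead_coef p) lead_coef_eq0 (negPf p_neq0).
  move=> i; rewrite -val_eqE /= => i_neq_d.
  rewrite big_ord1 /= fps_tinvXE eq_sym subn_eq0 leqNgt ltn_neqAle i_neq_d.
  by rewrite -ltnS /d prednK ?size_poly_gt0 // ltn_ord mulr0.
have tF0 : FracField.tofrac fps_tinv != 0 :> laurent.
  by rewrite tofrac_eq0 fps_tinv_neq0.
have pf : laurent_poly p * FracField.tofrac fps_tinv ^+ d = FracField.tofrac f.
  rewrite /laurent_poly horner_coef size_map_poly mulr_suml rmorph_sum /=.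
  apply: eq_bigr => i _; rewrite coef_map /= rmorphM rmorphXn /= -mulrA.
  congr (_ * _); rewrite /laurent_t exprVn.
  have i_le_d : (i <= d)%N by rewrite -ltnS /d prednK ?size_poly_gt0.
  by rewrite -{1}(subnK i_le_d) exprD mulrCA mulVf ?mulr1 // expf_neq0.
by apply: contra_neq f_neq0 => p0; apply/eqP; rewrite -tofrac_eq0 -pf p0 mul0r.
Qed.

Lemma frac_numden (x : {fraction {poly F}}) :
  x = FracField.tofrac \n_(repr x) / FracField.tofrac \d_(repr x).
Proof.
have dx0 : FracField.tofrac \d_(repr x) != 0 :> {fraction {poly F}}.
  by rewrite tofrac_eq0 denom_ratioP.
apply: (mulIf dx0); rewrite mulfVK //.
rewrite -{1}[x]reprK; unlock FracField.tofrac.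
rewrite -[LHS]FracField.pi_mul; apply/eqmodP; rewrite /= FracField.equivfE.
rewrite /FracField.mulf !numden_Ratio ?mulf_neq0 ?oner_eq0 ?denom_ratioP //.
by rewrite !mulr1 mulrC.
Qed.

Lemma laurent_rat_frac (p q : {poly F}) : q != 0 ->
  laurent_rat (FracField.tofrac p / FracField.tofrac q) =
  laurent_poly p / laurent_poly q.
Proof.
move=> q0; set x := _ / _; have := frac_numden x.
rewrite {1}/x /laurent_rat; set n := \n_(repr x); set d := \d_(repr x).
have d0 : d != 0 by exact: denom_ratioP.
move/eqP; rewrite eqr_div ?tofrac_eq0 // -!tofracM tofrac_eq => /eqP pd.
by apply/eqP; rewrite eqr_div ?laurent_poly_eq0 // -!rmorphM /= pd.
Qed.

Lemma laurent_rat_zmod : zmod_morphism laurent_rat.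
Proof.
move=> x y; rewrite (frac_numden x) (frac_numden y).
move: (denom_ratioP (repr x)) (denom_ratioP (repr y)).
move: (\n_(repr x)) (\d_(repr x)) (\n_(repr y)) (\d_(repr y)).
move=> n1 d1 n2 d2 d10 d20.
rewrite -mulNr addf_div ?tofrac_eq0 // -tofracN -!tofracM -tofracD.
rewrite !laurent_rat_frac ?mulf_neq0 // -mulNr addf_div ?laurent_poly_eq0 //.
by rewrite !(rmorphD, rmorphM, rmorphN).
Qed.

Lemma laurent_rat_monoid : monoid_morphism laurent_rat.
Proof.
split=> [|x y].
  rewrite -[1]divr1 -tofrac1 laurent_rat_frac ?oner_eq0 //.
  by rewrite rmorph1 divr1.
rewrite (frac_numden x) (frac_numden y).
move: (denom_ratioP (repr x)) (denom_ratioP (repr y)).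
move: (\n_(repr x)) (\d_(repr x)) (\n_(repr y)) (\d_(repr y)).
move=> n1 d1 n2 d2 d10 d20.
rewrite mulf_div -!tofracM !laurent_rat_frac ?mulf_neq0 //.
by rewrite !rmorphM mulf_div.
Qed.
HB.instance Definition _ := GRing.isZmodMorphism.Build
  {fraction {poly F}} laurent laurent_rat laurent_rat_zmod.
HB.instance Definition _ := GRing.isMonoidMorphism.Build
  {fraction {poly F}} laurent laurent_rat laurent_rat_monoid.

Lemma laurent_rat_poly p : laurent_rat (FracField.tofrac p) = laurent_poly p.
Proof.
rewrite -[X in laurent_rat X]divr1 -tofrac1 laurent_rat_frac ?oner_eq0 //.
by rewrite rmorph1 divr1.
Qed.

Lemma laurent_ratX : laurent_rat (FracField.tofrac 'X) = laurent_t.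
Proof. by rewrite laurent_rat_poly /laurent_poly map_polyX hornerX. Qed.

Lemma laurent_ratC c : laurent_rat (FracField.tofrac c%:P) = laurentC c.
Proof. by rewrite laurent_rat_poly /laurent_poly map_polyC hornerC. Qed.

Definition is_rational (f : fps F) : Prop :=
  exists x : {fraction {poly F}}, laurent_rat x = FracField.tofrac f.

End FPS.

(* Main.v *)
Require Import Defs.
From HB Require Import structures.
From mathcomp Require Import fingroup perm.
From mathcomp Require Import all_boot all_algebra.
From mathcomp Require Import finmap boolp monalg.
From mathcomp Require Import zify ring.

Set Implicit Arguments.
Unset Strict Implicit.
Unset Printing Implicit Defensive.

Import GRing.Theory.
Local Open Scope ring_scope.

(** Let eps be the linear form on F[x] with eps (x^a) = omega_a, so that
    e_1 p(y_1) e_1 = eps(p) e_1.  Say that q annihilates when eps vanishes on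
    the ideal (q).  Conditions (1), (2) and (3) all express the existence of a
    nonzero annihilating q: the coefficients of q(t) times the generating
    series at the powers t^-l are the values eps (q x^l)
    ([rational_annihilator], [annihilator_rational], [annihilator_recursion],
    [recursion_annihilator]).

    In every quotient of the affine algebra, s_1 p(y_1) e_1 = (refl p)(y_1) e_1
    for the operator refl on F[x] given by refl 1 = 1 and
    refl (p x) = - x refl p + eps p - p ([s_cyclic_vec]).  If e_1 is nonzero,
    e_1 s_1 = e_1 forces eps (refl p) = eps p; then refl is an involution, the
    ideal of annihilating polynomials is stable under refl, and its generator is
    sent to plus or minus itself since refl preserves leading terms up to sign.
    Multiplying the generator by x^2 keeps stability and provides the root 0
    ([refl_stable_annihilator]).  Conversely, if u is admissible, then the
    product m of the x - u_i is annihilating and refl-stable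
    ([admissible_annihilates], [admissible_refl]).

    So the heart of the matter is to build, from an annihilating refl-stable
    split polynomial m and one of its roots c, a finite dimensional
    representation in which e_1 is nonzero and y_1 is killed by m.  The space is
    spanned by diagrams with a single arc joining two points a and b, labelled by
    a residue w modulo m; the remaining points carry through strands, on which a
    dot acts by c.  Permutations move the points, turning the arc around applies
    refl to the label, a contraction e closes the arc (with value eps w) or
    slides it along a through strand (the dots are then evaluated at c), and y_1
    multiplies the label of an arc that ends at the first point by x.  Since
    y_(i+1) = s_i y_i s_i + s_i - e_i, only the Brauer relations and the
    relations of y_1 and y_2 have to be verified ([affBMW_rel_op]); they are
    checked on single arcs ([pair_brauer], [pair_dot]), and m(y_1) = 0 holds
    because m is divisible by x - c ([horner_op_dot]).

    One point more than strands is used.  With an arc at the second and third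
    points as input, e_1 moves it to the first two points without any factor
    omega_0, so e_1 acts by a nonzero operator even if all omega_a vanish
    ([stable_module]); and for n = 2 the element y_1^k e_1 sends this arc to the
    arc labelled x^k at the first two points, whence the linear independence
    that admissibility asks for ([stable_admissible]).

    Finally, if e_1 v is nonzero in a finite dimensional module, the vectors
    y_1^i e_1 v satisfy a linear relation with coefficients q, and applying
    e_1 y_1^l to it gives eps (q x^l) = 0 ([finite_module_annihilator]). *)

(** * Linear maps *)

Lemma linear_sumZ (F : fieldType) (U V : lmodType F) (h : U -> V) (I : finType)
  (a : I -> F) (x : I -> U) : linear h ->
  h (\sum_i a i *: x i) = \sum_i a i *: h (x i).
Proof.
move=> h_lin.
pose h' : {linear U -> V} := HB.pack h (GRing.isLinear.Build F U V *:%R h h_lin).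
rewrite -[h]/(h' : _ -> _) linear_sum; apply: eq_bigr => i _.
by rewrite linearZ.
Qed.

Lemma linear_zero (F : fieldType) (U V : lmodType F) (h : U -> V) : linear h -> h 0 = 0.
Proof.
by move=> h_lin; have := h_lin (-1) 0 0; rewrite scaler0 addr0 scaleN1r addNr.
Qed.

Lemma linear_scale (F : fieldType) (U V : lmodType F) (h : U -> V) a x :
  linear h -> h (a *: x) = a *: h x.
Proof.
by move=> h_lin; rewrite -[a *: x]addr0 h_lin linear_zero // addr0.
Qed.

Section LinearRules.
Variables (F : fieldType) (U V : vectType F).
Implicit Types (u v : U) (h : 'Hom(U, V)) (f : {linear U -> F^o}).

Lemma vectP u v : (forall f, f u = f v :> F) -> u = v.
Proof.
move=> uv; rewrite (coord_vbasis (memvf u)) (coord_vbasis (memvf v)).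
by apply: eq_bigr => i _; congr (_ *: _); exact: (uv (coord (vbasis fullv) i)).
Qed.

Lemma lfunD h u v : h (u + v) = h u + h v. Proof. exact: linearD. Qed.
Lemma lfunN h u : h (- u) = - h u. Proof. exact: linearN. Qed.
Lemma lfunZ h a u : h (a *: u) = a *: h u. Proof. exact: linearZ. Qed.
Lemma lfun0 h : h 0 = 0. Proof. exact: linear0. Qed.
Definition lfun_lin := (lfunD, lfunN, lfunZ, lfun0).

Lemma formD f u v : f (u + v) = f u + f v :> F. Proof. exact: linearD. Qed.
Lemma formN f u : f (- u) = - f u :> F. Proof. exact: linearN. Qed.
Lemma formZ f a u : f (a *: u) = a * f u :> F.
Proof. by rewrite -[RHS]/(a *: (f u : F^o)) linearZ. Qed.
Lemma form0 f : f 0 = 0 :> F. Proof. exact: linear0. Qed.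
Definition form_lin f := (formD f, formN f, formZ f, form0 f).

Lemma linfunE (h : U -> V) : linear h -> linfun h =1 h.
Proof.
move=> h_lin.
pose h' : {linear U -> V} := HB.pack h (GRing.isLinear.Build F U V *:%R h h_lin).
exact: (lfunE h').
Qed.
End LinearRules.

(** Decides equalities of linear combinations of vectors by testing them against
    an arbitrary linear form, which turns them into identities of a field. *)
Ltac vring := rewrite ?lfun_lin; let f := fresh "f" in
  apply: vectP => f; rewrite ?(form_lin f); ring.

(** * Modules over a presented algebra *)

Section Representations.
Variables (F : fieldType) (X : choiceType) (V : vectType F).
Variable g : X -> 'End(V).
Local Notation A := (freeAlg F X).

Definition word_op (k : {fmonom X}) : 'End(V) :=
  foldr (fun x f => g x \o f)%VF \1%VF (fmonom_val k).

Lemma word_opM k l : word_op (mmul k l) = (word_op k \o word_op l)%VF.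
Proof.
case: k l => [k] [l]; rewrite [mmul _ _]fmmulE /word_op /=.
by elim: k => [|x k IH] /=; rewrite ?comp_lfun1l // IH comp_lfunA.
Qed.

Definition free_op (a : A) : 'End(V) := \sum_(k <- msupp a) a@_k *: word_op k.

Lemma free_opEw (d : {fset {fmonom X}}) (a : A) : (msupp a `<=` d)%fset ->
  free_op a = \sum_(k <- d) a@_k *: word_op k.
Proof.
move=> le; rewrite [LHS](big_fset_incl _ le) => //= x xd /mcoeff_outdom ->.
by rewrite scale0r.
Qed.

Lemma free_op_is_linear : linear free_op.
Proof.
move=> c a b; pose d := (msupp a `|` msupp b)%fset.
have da : (msupp a `<=` d)%fset by exact: fsubsetUl.
have db : (msupp b `<=` d)%fset by exact: fsubsetUr.
have dab : (msupp (c *: a + b) `<=` d)%fset.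
  apply: fsubset_trans (msuppD_le _ _) _; rewrite fsubUset db andbT.
  exact: fsubset_trans (msuppZ_le _ _) da.
rewrite !(free_opEw da, free_opEw db, free_opEw dab) scaler_sumr -big_split /=.
by apply: eq_bigr => k _; rewrite mcoeffD mcoeffZ scalerDl scalerA.
Qed.
HB.instance Definition _ := GRing.isLinear.Build F A 'End(V) *:%R free_op
  free_op_is_linear.

Lemma free_opD a b : free_op (a + b) = free_op a + free_op b.
Proof. exact: linearD. Qed.
Lemma free_opB a b : free_op (a - b) = free_op a - free_op b.
Proof. exact: linearB. Qed.
Lemma free_opZ c a : free_op (c *: a) = c *: free_op a.
Proof. exact: linearZ. Qed.
Lemma free_op0 : free_op 0 = 0.
Proof. exact: linear0. Qed.

Lemma free_opU (k : {fmonom X}) (c : F) : free_op << c *g k >> = c *: word_op k.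
Proof. by rewrite (free_opEw msuppU_le) big_seq_fset1 mcoeffUU. Qed.

Lemma free_op1 : free_op 1 = \1%VF.
Proof. by rewrite free_opU scale1r /word_op [X in foldr _ _ X]fm1. Qed.

Lemma free_opM a b : free_op (a * b) = (free_op a \o free_op b)%VF.
Proof.
rewrite malgME linear_sum /=; apply/lfunP => v.
rewrite comp_lfunE [free_op a]/free_op !sum_lfunE; apply: eq_bigr => k _.
rewrite linear_sum !sum_lfunE scale_lfunE linear_sum scaler_sumr.
apply: eq_bigr => l _; rewrite /= free_opU word_opM !scale_lfunE comp_lfunE linearZ.
by rewrite scalerA.
Qed.

Lemma free_op_gen x : free_op (freeGen F x) = g x.
Proof. by rewrite free_opU scale1r /word_op fmuE /= comp_lfun1r. Qed.

Lemma free_op_subE a b v : free_op (a - b) v = free_op a v - free_op b v.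
Proof. by rewrite free_opB add_lfunE opp_lfunE. Qed.

Lemma free_op_addE a b v : free_op (a + b) v = free_op a v + free_op b v.
Proof. by rewrite free_opD add_lfunE. Qed.

Lemma free_op2 x y v :
  free_op (freeGen F x * freeGen F y) v = g x (g y v).
Proof. by rewrite free_opM comp_lfunE !free_op_gen. Qed.

Lemma free_op3 x y z v :
  free_op (freeGen F x * freeGen F y * freeGen F z) v = g x (g y (g z v)).
Proof. by rewrite free_opM comp_lfunE free_op_gen free_op2. Qed.

Variable rel : A -> A -> Prop.
Hypothesis rel_op : forall a b, rel a b -> free_op a = free_op b.

Definition pres_act (x : presAlg rel) (v : V) : V := free_op (repr x) v.

Lemma free_op_ideal z : in_ideal rel z -> free_op z = 0.
Proof.
elim=> [|a l r b {}z lr _ IH]; first exact: linear0.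
by rewrite linearD /= IH addr0 !free_opM linearB /= (rel_op lr) subrr
  comp_lfun0r comp_lfun0l.
Qed.

Lemma pres_actE a v : pres_act (presPi rel a) v = free_op a v.
Proof.
rewrite /pres_act; congr (fun_of_lfun _ v); apply/eqP; rewrite -subr_eq0 -linearB.
by rewrite /= free_op_ideal //; apply/presPi_eq; rewrite presPi_repr.
Qed.

Lemma pres_act_gen x v : pres_act (presGen rel x) v = g x v.
Proof. by rewrite pres_actE free_op_gen. Qed.

Lemma pres_act_module : is_module pres_act.
Proof.
split.
- move=> v c a b; rewrite -(presPi_repr a) -(presPi_repr b).
  rewrite -[c *: presPi _ _]presPi_Z -presPiD !pres_actE linearP /=.
  by rewrite add_lfunE scale_lfunE.
- by move=> a; exact: linearP.
- by move=> v; rewrite pres_actE free_op1 id_lfunE.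
move=> a b v; rewrite -(presPi_repr a) -(presPi_repr b).
by rewrite -[_ * _]presPi_M !pres_actE free_opM comp_lfunE.
Qed.
End Representations.

(** * The reflection on polynomials *)

Section LinearExtension.
Variables (F : fieldType) (V : lmodType F).
Implicit Types (f : nat -> V) (p : {poly F}).

Definition polyext f p : V := \sum_(i < size p) p`_i *: f i.

Lemma polyextEw n f p : (size p <= n)%N -> polyext f p = \sum_(i < n) p`_i *: f i.
Proof.
move=> le; rewrite /polyext (big_ord_widen n (fun i => p`_i *: f i) le).
rewrite big_mkcond /=; apply: eq_bigr => i _.
by case: ltnP => // le_i; rewrite nth_default ?scale0r.
Qed.

Lemma polyext_is_linear f : linear (polyext f).
Proof.
move=> c p q; pose n := maxn (size p) (size q).
have lp : (size p <= n)%N by rewrite leq_maxl.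
have lq : (size q <= n)%N by rewrite leq_maxr.
have lpq : (size (polyseq (c *: p + q)%R) <= n)%N.
  rewrite (leq_trans (size_polyD _ _)) // geq_max lq andbT.
  exact: leq_trans (size_scale_leq _ _) lp.
rewrite !(polyextEw _ lp, polyextEw _ lq, polyextEw _ lpq).
rewrite scaler_sumr -big_split; apply: eq_bigr => i _ /=.
by rewrite coefD coefZ scalerDl scalerA.
Qed.
HB.instance Definition _ f := GRing.isLinear.Build F {poly F} V *:%R (polyext f)
  (polyext_is_linear f).

Lemma polyextXn f k : polyext f 'X^k = f k.
Proof.
rewrite /polyext size_polyXn big_ord_recr /= coefXn eqxx scale1r big1 ?add0r //.
by move=> i _; rewrite coefXn ltn_eqF // scale0r.
Qed.

Lemma polyextC f c : polyext f c%:P = c *: f 0%N.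
Proof. by rewrite -[c%:P]mulr1 mul_polyC -(expr0 'X) linearZ /= polyextXn. Qed.

Lemma polyextMX f p : polyext f (p * 'X) = polyext (fun i => f i.+1) p.
Proof.
rewrite (@polyextEw (size p).+1); last first.
  by case: (eqVneq p 0) => [->|p0]; rewrite ?mul0r ?size_poly0 // size_mulX.
rewrite big_ord_recl coefMX scale0r add0r.
by apply: eq_bigr => i _; rewrite coefMX.
Qed.

Lemma eq_polyext f g : f =1 g -> polyext f =1 polyext g.
Proof. by move=> fg p; apply: eq_bigr => i _; rewrite fg. Qed.

Lemma polyext_comp (U : lmodType F) (h : V -> U) f p : linear h ->
  h (polyext f p) = \sum_(i < size p) p`_i *: h (f i).
Proof. exact: linear_sumZ. Qed.
End LinearExtension.

Lemma polyext_morph (F : fieldType) (U V : lmodType F) (h : V -> U) (f : nat -> V)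
  (g : nat -> U) p : linear h -> (forall i, h (f i) = g i) ->
  h (polyext f p) = polyext g p.
Proof.
by move=> hl hf; rewrite polyext_comp //; apply: eq_bigr => i _; rewrite hf.
Qed.

Section Reflection.
Variables (F : fieldType) (omega : nat -> F).
Implicit Types p q m h : {poly F}.

(** The linear form giving e_1 p(y_1) e_1 = eps p *: e_1. *)
Definition eps p : F := polyext (V := F^o) omega p.

Lemma eps_is_linear : linear (eps : _ -> F^o).
Proof. exact: linearP. Qed.
HB.instance Definition _ := GRing.isLinear.Build F {poly F} F^o *:%R eps
  eps_is_linear.

Lemma epsZ c p : eps (c *: p) = c * eps p.
Proof. exact: linearZ. Qed.

Lemma epsD p q : eps (p + q) = eps p + eps q.
Proof. exact: linearD. Qed.

Lemma epsXn k : eps 'X^k = omega k.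
Proof. exact: (@polyextXn F F^o). Qed.

(** [refl] encodes s_1 p(y_1) e_1 = (refl p)(y_1) e_1; the recursion comes from
    s_1 y_1 = y_2 s_1 + e_1 - 1, where y_2 acts on F[y_1] e_1 as - y_1. *)
Fixpoint reflX k : {poly F} :=
  if k is k'.+1 then - (reflX k' * 'X) + (omega k')%:P - 'X^k' else 1.

Definition refl p : {poly F} := polyext reflX p.
HB.instance Definition _ := GRing.Linear.copy refl (polyext reflX).

Lemma reflC c : refl c%:P = c%:P.
Proof. by rewrite /refl polyextC /= -mul_polyC mulr1. Qed.

Lemma reflMX p : refl (p * 'X) = - (refl p * 'X) + (eps p)%:P - p.
Proof.
have defp : p = \sum_(i < size p) p`_i *: 'X^i by rewrite -poly_def coefK.
rewrite /refl polyextMX [X in _ = _ - X]defp /eps /polyext /=.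
rewrite rmorph_sum /= mulr_suml -sumrN -sumrN -!big_split /=.
apply: eq_bigr => i _.
rewrite !scalerDr scalerN -scalerAl scalerN; congr (_ + _ - _).
by rewrite -mul_polyC -polyCM.
Qed.

Lemma size_refl p : (size (refl p) <= size p)%N.
Proof.
elim/poly_ind: p => [|p c IH]; first by rewrite linear0.
have [p0|p0] := eqVneq p 0.
  by rewrite p0 mul0r add0r reflC.
rewrite linearD /= reflMX reflC size_MXaddC (negPf p0) /=.
rewrite (leq_trans (size_polyD _ _)) // geq_max; apply/andP; split; last first.
  exact: leq_trans (size_polyC_leq1 _) _.
rewrite (leq_trans (size_polyD _ _)) // geq_max; apply/andP; split; last first.
  by rewrite size_polyN.
rewrite (leq_trans (size_polyD _ _)) // geq_max; apply/andP; split; last first.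
  exact: leq_trans (size_polyC_leq1 _) _.
rewrite size_polyN; have [->|q0] := eqVneq (refl p) 0; first by rewrite mul0r size_poly0.
by rewrite size_mulX.
Qed.

Lemma coef_refl p n : (size p <= n.+1)%N -> (refl p)`_n = (-1) ^+ n * p`_n.
Proof.
elim/poly_ind: p n => [|p c IH] n; first by rewrite linear0 !coef0 mulr0.
have [->|p0] := eqVneq p 0.
  by rewrite mul0r add0r reflC !coefC => _; case: eqP => [->|]; rewrite ?mul1r ?mulr0.
rewrite size_MXaddC (negPf p0) /= ltnS => sp.
case: n sp => [|n] sp; first by move: p0; rewrite -size_poly_eq0 -leqn0 sp.
rewrite linearD /= reflMX reflC !(coefD, coefN, coefMX, coefC) /= !addr0 IH //.
by rewrite (nth_default _ sp) oppr0 addr0 exprS mulN1r mulNr.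
Qed.

Definition weakly_admissible := forall p, eps (refl p) = eps p.
Hypothesis wadm : weakly_admissible.

(** Weak admissibility makes the square of [refl] commute with multiplication
    by 'X, and it fixes 1. *)
Lemma reflK : involutive refl.
Proof.
elim/poly_ind => [|p c IH]; first by rewrite !linear0.
rewrite linearD /= reflMX reflC !linearD !linearN /= reflMX !reflC wadm IH.
by ring.
Qed.

Definition annihilates q := forall h, eps (q * h) = 0.

(** For an annihilating q the rule for [refl] reads
    x refl q = - refl (q x) - q, so eps (refl q x^l) can be moved, up to sign,
    to eps (refl (q x^l)) = eps (q x^l) = 0. *)
Lemma refl_annihilates q : annihilates q -> annihilates (refl q).
Proof.
move=> qA h; elim/poly_ind: h q qA => [|h c IH] q qA.
  by rewrite mulr0 linear0.
have q0 : eps q = 0 by rewrite -[q]mulr1 qA.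
have qXA : annihilates (q * 'X) by move=> g; rewrite -mulrA qA.
rewrite mulrDr [_ * c%:P]mulrC mul_polyC linearD /= epsZ wadm q0 mulr0 addr0.
have -> : refl q * (h * 'X) = - (refl (q * 'X) * h) - q * h.
  by rewrite reflMX q0; ring.
by rewrite linearB linearN /= IH // qA subr0 oppr0.
Qed.

(** An annihilating polynomial p of least degree satisfies refl p = + p or - p,
    since the difference annihilates and has smaller degree.  The extra factor
    'X * 'X commutes with [refl] on annihilating polynomials; it provides a
    root, and a positive degree when all omega_a vanish. *)
Lemma refl_stable_annihilator q : q != 0 -> annihilates q ->
  exists m, [/\ m \is monic, annihilates m, m %| refl m & root m 0].
Proof.
move=> q0 qA.
pose P n := `[< exists p, [/\ p != 0, annihilates p & size p = n] >].
have exP : exists n, P n by exists (size q); apply/asboolP; exists q.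
case: (ex_minnP exP) => n /asboolP[p [p0 pA szp]] pmin.
have rp : refl p = (-1) ^+ n.-1 *: p.
  apply/eqP; rewrite -subr_eq0; apply/negP => /negP d0.
  set d := _ - _ in d0.
  have dA : annihilates d.
    move=> h; rewrite /d mulrBl -scalerAl linearB /= epsZ pA mulr0.
    by rewrite refl_annihilates ?subr0.
  have /pmin : P (size d) by apply/asboolP; exists d.
  apply/negP; rewrite -ltnNge.
  have n0 : (0 < n)%N by rewrite -szp size_poly_gt0.
  rewrite -(prednK n0) ltnS; apply/leq_sizeP => j.
  rewrite leq_eqVlt => /orP[/eqP <-|lt_j].
    by rewrite /d coefB coefZ coef_refl ?subrr // prednK // szp.
  have le_j : (n <= j)%N by rewrite -(prednK n0).
  rewrite /d coefB coefZ !nth_default ?szp ?mulr0 ?subr0 //.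
  by rewrite (leq_trans (size_refl p)) ?szp.
pose p1 := (lead_coef p)^-1 *: p.
have lp0 : lead_coef p != 0 by rewrite lead_coef_eq0.
have p1A : annihilates p1 by move=> h; rewrite -scalerAl epsZ pA mulr0.
have rp1 : refl p1 = (-1) ^+ n.-1 *: p1.
  by rewrite linearZ /= rp !scalerA mulrC.
have p1m : p1 \is monic by rewrite monicE lead_coefZ mulVf.
exists (p1 * 'X * 'X); split.
- by rewrite !monicMr // monicX.
- by move=> h; rewrite -!mulrA.
- have e0 : eps p1 = 0 by rewrite -[p1]mulr1 p1A.
  rewrite !reflMX p1A e0 rp1 polyC0.
  suff -> : - ((- ((-1) ^+ n.-1 *: p1 * 'X) + 0 - p1) * 'X) + 0 - p1 * 'X =
     (-1) ^+ n.-1 *: (p1 * 'X * 'X) by rewrite dvdpZr ?signr_eq0.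
  rewrite -!mul_polyC; ring.
by rewrite rootE hornerMX mulr0.
Qed.
End Reflection.

(** * From the first dot to all affine relations *)

Section Reduction.
Variables (F : fieldType) (V : vectType F) (omega : nat -> F) (N : nat).
Variables (s e : nat -> 'End(V)) (y0 : 'End(V)).

(** The operators of y_1, y_2, and so on, determined from that of y_1 by the
    relation between s_i, y_i and y_(i+1), in the manner of Jucys-Murphy
    elements. *)
Fixpoint jucys (j : nat) : 'End(V) :=
  if j is i.+1 then (s i \o jucys i \o s i + s i - e i)%VF else y0.

Lemma jucysS i v : jucys i.+1 v = s i (jucys i (s i v)) + s i v - e i v.
Proof. by rewrite /= !add_lfunE opp_lfunE !comp_lfunE. Qed.

Arguments jucys : simpl never.

Record brauer_action : Prop := BrauerAction {
  bra_ss : forall i v, (i.+1 < N)%N -> s i (s i v) = v;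
  bra_ss_comm : forall i j v, distant i j -> (i.+1 < N)%N -> (j.+1 < N)%N ->
    s i (s j v) = s j (s i v);
  bra_braid : forall i v, (i.+2 < N)%N ->
    s i (s i.+1 (s i v)) = s i.+1 (s i (s i.+1 v));
  bra_ee : forall i v, (i.+1 < N)%N -> e i (e i v) = omega 0%N *: e i v;
  bra_se_comm : forall i j v, distant i j -> (i.+1 < N)%N -> (j.+1 < N)%N ->
    s i (e j v) = e j (s i v);
  bra_ee_comm : forall i j v, distant i j -> (i.+1 < N)%N -> (j.+1 < N)%N ->
    e i (e j v) = e j (e i v);
  bra_es : forall i v, (i.+1 < N)%N -> e i (s i v) = e i v;
  bra_se : forall i v, (i.+1 < N)%N -> s i (e i v) = e i v;
  bra_see : forall i v, (i.+2 < N)%N -> s i (e i.+1 (e i v)) = s i.+1 (e i v);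
  bra_ees : forall i v, (i.+2 < N)%N -> e i (e i.+1 (s i v)) = e i (s i.+1 v);
  bra_ees' : forall i v, (i.+2 < N)%N -> e i.+1 (e i (s i.+1 v)) = e i.+1 (s i v);
  bra_see' : forall i v, (i.+2 < N)%N -> s i.+1 (e i (e i.+1 v)) = s i (e i.+1 v);
  bra_eee : forall i v, (i.+2 < N)%N -> e i.+1 (e i (e i.+1 v)) = e i.+1 v;
  bra_eee' : forall i v, (i.+2 < N)%N -> e i (e i.+1 (e i v)) = e i v }.

(** The relations with dots from which the others follow by the recursion for
    [jucys]. *)
Record first_dot_action : Prop := FirstDotAction {
  dot_s : forall i v, (0 < i)%N -> (i.+1 < N)%N -> s i (y0 v) = y0 (s i v);
  dot_e : forall i v, (0 < i)%N -> (i.+1 < N)%N -> e i (y0 v) = y0 (e i v);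
  dot_eye : forall a v, e 0%N (iter a y0 (e 0%N v)) = omega a *: e 0%N v;
  dot_comm : forall v, y0 (jucys 1 v) = jucys 1 (y0 v);
  dot_ey : forall v, e 0%N (y0 v + jucys 1 v) = 0;
  dot_ye : forall v, y0 (e 0%N v) + jucys 1 (e 0%N v) = 0 }.

Hypotheses (bra : brauer_action) (dot : first_dot_action).

Let ss := bra_ss bra.
Let braid := bra_braid bra.

Lemma bra_sse i v : (i.+2 < N)%N -> s i (s i.+1 (e i v)) = e i.+1 (e i v).
Proof. by move=> iN; rewrite -(bra_see bra) // ss // ltnW. Qed.

Lemma bra_ess i v : (i.+2 < N)%N -> e i (s i.+1 (s i v)) = e i (e i.+1 v).
Proof. by move=> iN; rewrite -(bra_ees bra) // ss // ltnW. Qed.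

Lemma bra_ess' i v : (i.+2 < N)%N -> e i.+1 (s i (s i.+1 v)) = e i.+1 (e i v).
Proof. by move=> iN; rewrite -(bra_ees' bra) // ss. Qed.

Lemma bra_sse' i v : (i.+2 < N)%N -> s i.+1 (s i (e i.+1 v)) = e i (e i.+1 v).
Proof. by move=> iN; rewrite -(bra_see' bra) // ss. Qed.

Lemma bra_ese i v : (i.+2 < N)%N -> e i (s i.+1 (e i v)) = e i v.
Proof.
move=> iN; have iN' := ltnW iN.
by rewrite -(bra_see bra) // bra_es // (bra_eee' bra).
Qed.

(** Contractions at neighbouring places are conjugate, which lets relations
    at i be transported to i.+1. *)
Lemma bra_conj i v : (i.+2 < N)%N ->
  s i (s i.+1 (e i (s i.+1 (s i v)))) = e i.+1 v.
Proof. by move=> iN; rewrite bra_ess // bra_sse // (bra_eee bra). Qed.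

(** By induction on j through the recursive definition; when s_i and e_i do not
    commute with the generators of index j - 1, that is for j = i + 2, two steps
    of the recursion have to be unfolded. *)
Lemma jucys_comm_se i j v : (i.+1 < N)%N -> (j < N)%N -> i <> j -> i.+1 <> j ->
  s i (jucys j v) = jucys j (s i v) /\ e i (jucys j v) = jucys j (e i v).
Proof.
elim/ltn_ind: j i v => -[|j] IH i v iN jN ij iSj.
  have i0 : (0 < i)%N by case: i ij {iN iSj}.
  by split; [exact: dot_s | exact: dot_e].
have [iSj'|iSj'] := eqVneq i.+1 j.
  have {ij iSj jN} jN : (i.+2 < N)%N by rewrite iSj'.
  have [YS YE] : (forall u, s i.+1 (jucys i u) = jucys i (s i.+1 u)) /\
      (forall u, e i.+1 (jucys i u) = jucys i (e i.+1 u)).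
    have ij' : (i < j.+1)%N by lia.
    by split=> u; have [||||//] := IH i ij' i.+1 u; lia.
  move: IH => _; rewrite -iSj'; split.
    rewrite !jucysS.
    rewrite !(lfunD, lfunN).
    rewrite !(braid _ jN) -YS !ss // -(bra_conj (s i v)) // -(bra_conj v) //.
    rewrite !ss //.
    vring.
  rewrite !jucysS.
  rewrite !(lfunD, lfunN).
  rewrite !(bra_ess _ jN) !(bra_ese _ jN) !(bra_sse _ jN) -[jucys i (e i.+1 _)]YE.
  rewrite (bra_sse' _ jN) !YE (bra_ess' _ jN) (bra_es bra) // (bra_se bra) //.
  vring.
have dij : distant i j by rewrite /distant; lia.
have dji : distant j i by rewrite /distant; lia.
have jN' : (j < N)%N by exact: ltnW.
have jj : (j < j.+1)%N by [].
have ij' : i <> j by lia.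
have iSj'' : i.+1 <> j by lia.
have YS u := (IH j jj i u iN jN' ij' iSj'').1.
have YE u := (IH j jj i u iN jN' ij' iSj'').2.
have sC u := bra_ss_comm bra u dij iN jN.
have seC u := bra_se_comm bra u dij iN jN.
have seC' u := bra_se_comm bra u dji jN iN.
have eC u := bra_ee_comm bra u dij iN jN.
rewrite !jucysS !(lfunD, lfunN).
by rewrite !sC !seC -!seC' !eC YS YE sC -seC'.
Qed.

Definition jucys_s i j v iN jN ij Sij := (@jucys_comm_se i j v iN jN ij Sij).1.
Definition jucys_e i j v iN jN ij Sij := (@jucys_comm_se i j v iN jN ij Sij).2.

Lemma jucys_sl i v : (i.+1 < N)%N ->
  s i (jucys i.+1 v) = jucys i (s i v) + v - e i v.
Proof.
by move=> iN; rewrite jucysS !(lfunD, lfunN) !ss // (bra_se bra).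
Qed.

Lemma jucys_comm i j v : (i < N)%N -> (j < N)%N ->
  jucys i (jucys j v) = jucys j (jucys i v).
Proof.
wlog ij : i j v / (i < j)%N => [W|] iN jN.
  by case: (ltngtP i j) => [||->] // ij; [|apply: esym]; apply: W.
elim: i j ij v iN jN => [|i IH] j ij v iN jN; last first.
  have [ji Sij] : i <> j /\ i.+1 <> j by lia.
  have YS u := jucys_s u iN jN ji Sij; have YE u := jucys_e u iN jN ji Sij.
  have ij' : (i < j)%N by exact: ltnW.
  by rewrite !jucysS !(lfunD, lfunN) !YS !YE IH ?(ltnW iN) // YS.
change (jucys 0) with y0.
elim: j v jN ij => // -[_ v|j IHj v jN _]; first by rewrite (dot_comm dot).
rewrite !(jucysS j.+1) !(lfunD, lfunN) -!(dot_s dot) // -(dot_e dot) //.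
by rewrite (IHj _ (ltnW jN) isT) -(dot_s dot).
Qed.

(** Conjugation by s_i s_(i+1) reduces i.+1 to i: it turns y_(i+1) + y_(i+2)
    into y_i + y_(i+1) plus terms that e_i kills by the Brauer relations. *)
Lemma jucys_ey i v : (i.+1 < N)%N -> e i (jucys i v + jucys i.+1 v) = 0.
Proof.
elim: i v => [|i IH] v iN; first exact: (dot_ey dot).
have iN' := ltnW iN.
set w := jucys _ v + _; rewrite -(bra_conj w iN) {}/w.
rewrite [s i (_ + _)]lfunD (jucys_sl v iN').
have [ji Sij] : i <> i.+2 /\ i.+1 <> i.+2 by lia.
have [ji' Sij'] : i.+1 <> i /\ i.+2 <> i by lia.
rewrite (jucys_s v iN' iN ji Sij).
suff -> : e i (s i.+1 (jucys i (s i v) + v - e i v + jucys i.+2 (s i v))) = 0.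
  by rewrite !lfun0.
rewrite !(lfunD, lfunN) (jucys_s _ iN (ltnW iN') ji' Sij') (jucys_sl _ iN).
have := IH (s i.+1 (s i v)) iN'; rewrite lfunD => /addr0_eq E.
rewrite !(lfunD, lfunN) -E (bra_ese _ iN) (bra_es bra _ iN').
rewrite (bra_ees bra _ iN).
vring.
Qed.

Lemma jucys_ye i v : (i.+1 < N)%N -> jucys i (e i v) + jucys i.+1 (e i v) = 0.
Proof.
elim: i v => [|i IH] v iN; first exact: (dot_ye dot).
have iN' := ltnW iN.
have [ji Sij] : i <> i.+2 /\ i.+1 <> i.+2 by lia.
have [ji' Sij'] : i.+1 <> i /\ i.+2 <> i by lia.
rewrite -(bra_conj v iN); set z := s i.+1 (s i v).
rewrite -[X in _ + X](jucys_s _ iN' iN ji Sij) [X in X + _](jucysS i).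
rewrite (jucysS i.+1) !(ss _ iN) !(ss _ iN').
rewrite -(jucys_s _ iN (ltnW iN') ji' Sij') (bra_es bra _ iN').
rewrite (bra_ese _ iN) (bra_es bra _ iN) !(lfunD, lfunN).
rewrite (bra_se bra _ iN') (bra_see bra _ iN).
have /addr0_eq <- := IH z iN'.
vring.
Qed.

End Reduction.

Section AffineRepresentation.
Variables (F : fieldType) (V : vectType F) (omega : nat -> F) (N : nat).
Variables (s e : nat -> 'End(V)) (y0 : 'End(V)).
Local Notation jucys := (jucys s e y0).
Hypotheses (bra : brauer_action omega N s e) (dot : first_dot_action omega N s e y0).
Variable n : nat.
Hypothesis nN : (n <= N)%N.

Definition bmw_gen (x : bmwIndex n) : 'End(V) :=
  match x with
  | inl (inl i) => s i
  | inl (inr i) => e i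
  | inr j => jucys j
  end.

(** Because of this, a representation has to be checked on the Brauer generators,
    y_1 and y_2 only. *)
Lemma affBMW_rel_op a b :
  affBMW_rel omega a b -> free_op bmw_gen a = free_op bmw_gen b.
Proof.
have bound (i : 'I_n.-1) : (i.+1 < N)%N by have := ltn_ord i; lia.
have bound2 (i j : 'I_n.-1) : j = i.+1 :> nat -> (i.+2 < N)%N.
  by move=> ji; have := bound j; rewrite ji.
have boundy (j : 'I_n) : (j < N)%N by exact: leq_trans (ltn_ord j) nN.
case=> [i|i j d|i j ji|i j ji jSi|i|i j c i0 j0 _|i j d|i j d|i j ji jSi|i j|i|i
  |i j ji|i j ji|i j ji|i j ji|i j ji|i j ji
  |i j k ji ki|i j k ji ki|i j k ji ki|i j k ji ki]; apply/lfunP => v.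
- by rewrite [LHS]free_op2 free_op1 id_lfunE (bra_ss bra).
- by rewrite [LHS]free_op2 [RHS]free_op2 (bra_ss_comm bra).
- by rewrite [LHS]free_op3 [RHS]free_op3 /= ji (bra_braid bra) ?(bound2 _ _ ji).
- rewrite [LHS]free_op2 [RHS]free_op2.
  by apply: (jucys_s bra dot); rewrite // => /esym.
- by rewrite [LHS]free_op2 free_opZ scale_lfunE free_op_gen (bra_ee bra).
- rewrite free_opM comp_lfunE free_op_gen free_opM comp_lfunE free_op_gen.
  rewrite free_opZ scale_lfunE free_op_gen /=.
  have powE w : free_op bmw_gen (freeGen F (inr j : bmwIndex n) ^+ c) w = iter c y0 w.
    elim: c => [|c IH]; first by rewrite expr0 free_op1 id_lfunE.
    by rewrite exprS free_opM comp_lfunE free_op_gen IH /= j0.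
  by rewrite powE i0 (dot_eye dot).
- by rewrite [LHS]free_op2 [RHS]free_op2 (bra_se_comm bra).
- by rewrite [LHS]free_op2 [RHS]free_op2 (bra_ee_comm bra).
- rewrite [LHS]free_op2 [RHS]free_op2.
  by apply: (jucys_e bra dot); rewrite // => /esym.
- by rewrite [LHS]free_op2 [RHS]free_op2; exact: (jucys_comm bra dot).
- by rewrite [LHS]free_op2 free_op_gen (bra_es bra).
- by rewrite [LHS]free_op2 free_op_gen (bra_se bra).
- by rewrite [LHS]free_op3 [RHS]free_op2 /= ji (bra_see bra) ?(bound2 _ _ ji).
- by rewrite [LHS]free_op3 [RHS]free_op2 /= ji (bra_ees bra) ?(bound2 _ _ ji).
- by rewrite [LHS]free_op3 [RHS]free_op2 /= ji (bra_ees' bra) ?(bound2 _ _ ji).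
- by rewrite [LHS]free_op3 [RHS]free_op2 /= ji (bra_see' bra) ?(bound2 _ _ ji).
- by rewrite [LHS]free_op3 free_op_gen /= ji (bra_eee bra) ?(bound2 _ _ ji).
- by rewrite [LHS]free_op3 free_op_gen /= ji (bra_eee' bra) ?(bound2 _ _ ji).
- rewrite [LHS]free_op_subE [RHS]free_op_subE.
  rewrite [X in X - _ = _]free_op2 [X in _ - X = _]free_op2.
  rewrite [X in _ = fun_of_lfun X _ - _]free_op_gen free_op1 id_lfunE /= ji ki.
  rewrite jucysS.
  rewrite (bra_ss bra) // (bra_es bra) //; vring.
- rewrite [LHS]free_op_subE [RHS]free_op_subE.
  rewrite [X in X - _ = _]free_op2 [X in _ - X = _]free_op2.
  rewrite [X in _ = fun_of_lfun X _ - _]free_op_gen free_op1 id_lfunE /=.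
  rewrite ji ki (jucys_sl _ bra) //; vring.
- rewrite free_opM comp_lfunE free_op_gen free_op_addE 2!free_op_gen.
  by rewrite free_op0 zero_lfunE /= ji ki (jucys_ey bra dot).
- rewrite free_opM comp_lfunE free_op_gen free_op_addE 2!free_op_gen.
  by rewrite free_op0 zero_lfunE /= ji ki (jucys_ye bra dot).
Qed.
End AffineRepresentation.

(** * Arcs labelled by a vector space *)

Section PairModule.
Variables (F : fieldType) (W : vectType F) (X S : 'End(W)) (one : W).
Variables (eps eta : {linear W -> F^o}) (c : F) (omega : nat -> F).

(** Properties of the left ideal F[y_1] e_1 as the space of labels of an arc:
    [X] is the multiplication by y_1, [S] the action of s_1, [one] the label of
    an arc without dots, [eps] the value of a closed arc, and [eta] the
    evaluation of dots at the scalar [c] by which they act on through strands. *)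
Record arc_label : Prop := ArcLabel {
  lab_S1 : S one = one;
  lab_SS : forall w, S (S w) = w;
  lab_SX : forall w, S (X w) = - X (S w) + eps w *: one - w;
  lab_epsS : forall w, eps (S w) = eps w;
  lab_eta1 : eta one = 1;
  lab_etaX : forall w, eta (X w) = c * eta w;
  lab_epsX : forall a, eps (iter a X one) = omega a }.

Hypothesis lab : arc_label.
Let SS := lab_SS lab.

Variable m : nat.
Local Notation I := 'I_m.+1.

Local Notation pairs := {t : I * I | (t.1 < t.2)%N}.
(** An unordered pair of points is represented by its increasing ordering. *)
Definition pair_space_type : Type := {ffun {t : I * I | (t.1 < t.2)%N} -> W}.
HB.instance Definition _ := Vector.on pair_space_type.
Definition pair_space : vectType F := pair_space_type.
Local Notation V := pair_space.
Implicit Types (a b i j k o p : I) (w : W) (v : V) (g : {perm I}).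

(** The diagram with one arc from a to b, labelled w at the end a; seen from
    the other end the label is [S w]. *)
Definition arc a b w : V :=
  [ffun t => if val t == (a, b) then w else if val t == (b, a) then S w else 0].

Lemma arc_is_linear a b : linear (arc a b).
Proof.
move=> x u w; apply/ffunP => t; rewrite !ffunE.
by case: eqP => // _; case: eqP => _; rewrite ?linearP // scaler0 addr0.
Qed.
HB.instance Definition _ a b := GRing.isLinear.Build F W V *:%R (arc a b)
  (arc_is_linear a b).

Lemma arcD a b u w : arc a b (u + w) = arc a b u + arc a b w. Proof. exact: linearD. Qed.
Lemma arcN a b w : arc a b (- w) = - arc a b w. Proof. exact: linearN. Qed.
Lemma arcZ a b x w : arc a b (x *: w) = x *: arc a b w. Proof. exact: linearZ. Qed.
Lemma arc0 a b : arc a b 0 = 0. Proof. exact: linear0. Qed.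
Definition pair_lin := (lfun_lin, (arcD, arcN, arcZ, arc0), form_lin eps, form_lin eta).

Lemma arc_sym a b w : a != b -> arc b a w = arc a b (S w).
Proof.
move=> ab; apply/ffunP => t; rewrite !ffunE SS.
by case: eqP => [->|] //; case: eqP => // -[] /eqP; rewrite eq_sym (negPf ab).
Qed.

Lemma arc_sum v : v = \sum_t arc (val t).1 (val t).2 (v t).
Proof.
apply/ffunP => t; rewrite sum_ffunE (bigD1 t) //= big1 ?addr0.
  by rewrite ffunE -surjective_pairing eqxx.
move=> t' tt'; rewrite ffunE -surjective_pairing val_eqE eq_sym (negPf tt').
case: eqP => // E; have := valP t; have := valP t'.
by rewrite E /= => /ltnW; rewrite leqNgt => /negPf ->.
Qed.

Lemma arc_ind (P : V -> Prop) : P 0 -> (forall u v, P u -> P v -> P (u + v)) ->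
  (forall a b w, a != b -> P (arc a b w)) -> forall v, P v.
Proof.
move=> P0 PD Parc v; rewrite (arc_sum v).
elim/big_ind: _ => // -[[a b] /= ab] _; apply: Parc.
by apply: contraTneq ab => ->; rewrite ltnn.
Qed.

(** Takes the value [f a b w] on [arc a b w] as soon as f a b is linear and
    compatible with turning the arc around. *)
Definition arc_op (f : I -> I -> W -> V) : 'End(V) :=
  linfun (fun v => \sum_t f (val t).1 (val t).2 (v t)).

Lemma arc_opE f : (forall a b, linear (f a b)) ->
  (forall a b w, a != b -> f b a w = f a b (S w)) ->
  forall a b w, a != b -> arc_op f (arc a b w) = f a b w.
Proof.
move=> f_lin f_sym.
have ext_lin : linear (fun v : V => \sum_t f (val t).1 (val t).2 (v t)).
  move=> x u v; rewrite scaler_sumr -big_split; apply: eq_bigr => t _ /=.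
  by rewrite !ffunE f_lin.
have f0 a b : f a b 0 = 0 by exact: linear_zero.
have main a b w : (a < b)%N -> arc_op f (arc a b w) = f a b w.
  move=> ab; rewrite /arc_op (linfunE ext_lin).
  have abP : ((a, b).1 < (a, b).2)%N by [].
  rewrite (bigD1 (Sub (a, b) abP : pairs)) //= big1 ?addr0 ?ffunE ?SubK ?eqxx //.
  move=> -[[a' b'] /= ab'] ne; rewrite !ffunE /=.
  case: eqP => [E|_]; first by case/eqP: ne; apply: val_inj.
  case: eqP => [[E1 E2]|_]; last exact: f0.
  by move: (ab') ab; rewrite /= E1 E2 => /ltnW; rewrite leqNgt => /negPf ->.
move=> a b w ab; have := ab; rewrite -val_eqE neq_ltn => /orP[/main //|ba].
by rewrite arc_sym 1?eq_sym // main // f_sym ?SS // eq_sym.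
Qed.

Definition perm_op g : 'End(V) := arc_op (fun a b => arc (g a) (g b)).

(** The scalar by which the contraction at i and j multiplies the undotted arc
    between i and j: an arc with both ends there is closed, an arc with one end
    there is straightened, its dots sliding to a through strand; for an arc that
    misses i and j two through strands would be joined, giving 0. *)
Definition contraction i j a b w : F :=
  if a \in pred2 i j then if b \in pred2 i j then eps w else eta (S w)
  else if b \in pred2 i j then eta w else 0.

Definition contract_op i j : 'End(V) :=
  arc_op (fun a b w => contraction i j a b w *: arc i j one).

(** The conjugate x_3 of y_1 by the transposition (13) is related to y_3 by
    y_3 = x_3 + (13) + (23) - e_13 - e_23.  On an arc at the first two points y_3
    is to act by the scalar c; solving for x_3 gives the last formula. *)
Definition dot_fun o a b w : V :=
  if a == o then arc o b (X w) else if b == o then arc o a (X (S w)) else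
  c *: arc a b w - arc o b w - arc o a (S w) + eta (S w) *: arc o a one
  + eta w *: arc o b one.
Definition dot_op o : 'End(V) := arc_op (dot_fun o).

Lemma perm_opE g a b w : a != b -> perm_op g (arc a b w) = arc (g a) (g b) w.
Proof.
move=> ab; rewrite arc_opE // => [a' b'|a' b' w' ab']; first exact: linearP.
by rewrite arc_sym ?(inj_eq perm_inj).
Qed.

Lemma contraction_lin i j a b : linear (contraction i j a b : W -> F^o).
Proof.
move=> x u v; rewrite /contraction.
by case: ifP => _; case: ifP => _; rewrite ?linearP ?scaler0 ?addr0.
Qed.

Lemma contractionE i j a b x u w :
  contraction i j a b (x *: u + w) = x * contraction i j a b u + contraction i j a b w.
Proof. exact: contraction_lin. Qed.

Lemma contract_opE i j a b w : a != b ->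
  contract_op i j (arc a b w) = contraction i j a b w *: arc i j one.
Proof.
move=> ab; rewrite arc_opE // => [a' b' x u v|a' b' w' _].
  by rewrite contractionE scalerDl scalerA.
congr (_ *: _); rewrite /contraction SS (lab_epsS lab).
by case: ifP => _; case: ifP.
Qed.

Lemma dot_opE o a b w : a != b -> dot_op o (arc a b w) = dot_fun o a b w.
Proof.
move=> ab; rewrite arc_opE // {a b w ab} => [a b x u v|a b w ab].
  rewrite /dot_fun; by case: ifP => _; [|case: ifP => _]; rewrite ?pair_lin; vring.
rewrite /dot_fun; case: (eqVneq b o) => [bo|bo]; case: (eqVneq a o) => [ao|ao] //.
- by rewrite ao bo eqxx in ab.
- by rewrite SS.
rewrite arc_sym // SS; vring.
Qed.

Local Notation cup i j := (arc i j one).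

Lemma cup_sym i j : i != j -> cup j i = cup i j.
Proof. by move=> ij; rewrite arc_sym // (lab_S1 lab). Qed.

Lemma contraction_sym i j a b w : contraction j i a b w = contraction i j a b w.
Proof. by rewrite /contraction !inE ![_ || (_ == i)]orbC. Qed.

Lemma contractionJ g i j a b w :
  contraction (g i) (g j) (g a) (g b) w = contraction i j a b w.
Proof. by rewrite /contraction !inE !(inj_eq perm_inj). Qed.

Lemma perm_opJ g i j v : i != j ->
  perm_op g (contract_op i j v) = contract_op (g i) (g j) (perm_op g v).
Proof.
move=> ij; elim/arc_ind: v => [|u v IHu IHv|a b w ab].
- by rewrite !lfun0.
- by rewrite !lfunD IHu IHv.
rewrite contract_opE // lfunZ !perm_opE // contract_opE ?(inj_eq perm_inj) //.
by rewrite contractionJ.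
Qed.

Lemma perm_opM g h v : perm_op g (perm_op h v) = perm_op (h * g)%g v.
Proof.
elim/arc_ind: v => [|u v IHu IHv|a b w ab].
- by rewrite !lfun0.
- by rewrite !lfunD IHu IHv.
by rewrite !perm_opE ?(inj_eq perm_inj) // !permM.
Qed.

Lemma perm_op1 v : perm_op 1%g v = v.
Proof.
elim/arc_ind: v => [|u v IHu IHv|a b w ab].
- by rewrite !lfun0.
- by rewrite !lfunD IHu IHv.
by rewrite !perm_opE // !perm1.
Qed.

Lemma contract_op_cup i j v : exists l, contract_op i j v = l *: cup i j.
Proof.
elim/arc_ind: v => [|u v [lu IHu] [lv IHv]|a b w ab].
- by exists 0; rewrite lfun0 scale0r.
- by exists (lu + lv); rewrite lfunD IHu IHv scalerDl.
by rewrite contract_opE //; exists (contraction i j a b w).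
Qed.

Lemma contract_cup1 i j : i != j -> contract_op i j (cup i j) = omega 0%N *: cup i j.
Proof.
move=> ij; rewrite contract_opE // /contraction !inE !eqxx orbT.
by rewrite -(lab_epsX lab).
Qed.

Lemma contract_cup2 i j k : i != j -> j != k -> i != k ->
  contract_op j k (cup i j) = cup j k.
Proof.
move=> ij jk ik; rewrite contract_opE // /contraction !inE (negPf ij) (negPf ik).
by rewrite eqxx (lab_eta1 lab) scale1r.
Qed.

Lemma contract_cup0 i j k l : i != j -> [&& k != i, k != j, l != i & l != j] ->
  contract_op k l (cup i j) = 0.
Proof.
move=> ij /and4P[ki kj li lj]; rewrite contract_opE // /contraction !inE.
by rewrite ![i == _]eq_sym ![j == _]eq_sym !(negPf ki, negPf kj, negPf li, negPf lj)
  scale0r.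
Qed.

Lemma perm_op_cup g i j : i != j -> perm_op g (cup i j) = cup (g i) (g j).
Proof. by move=> ij; rewrite perm_opE. Qed.

Lemma contract_opC i j v : i != j -> contract_op j i v = contract_op i j v.
Proof.
move=> ij; elim/arc_ind: v => [|u v IHu IHv|a b w ab].
- by rewrite !lfun0.
- by rewrite !lfunD IHu IHv.
by rewrite !contract_opE // contraction_sym cup_sym.
Qed.

Lemma contract_op_perm i j v : i != j ->
  contract_op i j (perm_op (tperm i j) v) = contract_op i j v.
Proof.
move=> ij; elim/arc_ind: v => [|u v IHu IHv|a b w ab].
- by rewrite !lfun0.
- by rewrite !lfunD IHu IHv.
rewrite perm_opE // !contract_opE ?(inj_eq perm_inj) //.
by rewrite -(contractionJ (tperm i j)) !tpermK tpermL tpermR contraction_sym.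
Qed.

Lemma perm_contract_op i j v : i != j ->
  perm_op (tperm i j) (contract_op i j v) = contract_op i j v.
Proof.
move=> ij; have [l ->] := contract_op_cup i j v.
by rewrite lfunZ perm_op_cup // tpermL tpermR cup_sym.
Qed.

Section ThreePoints.
Variables (i j k : I) (v : V).
Hypotheses (ij : i != j) (jk : j != k) (ik : i != k).

Lemma perm_braid :
  perm_op (tperm i j) (perm_op (tperm j k) (perm_op (tperm i j) v)) =
  perm_op (tperm j k) (perm_op (tperm i j) (perm_op (tperm j k) v)).
Proof.
rewrite !perm_opM; suff -> : (tperm i j * (tperm j k * tperm i j) =
    tperm j k * (tperm i j * tperm j k))%g by [].
apply/perm.permP => a; rewrite !permM.
rewrite [LHS](inj_tperm _ _ _ perm_inj) [RHS](inj_tperm _ _ _ perm_inj) !tpermK.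
by rewrite tpermR tpermL [tperm i j k]tpermD ?[tperm j k i]tpermD // eq_sym.
Qed.

Lemma perm_contract_contract :
  perm_op (tperm i j) (contract_op j k (contract_op i j v)) =
  perm_op (tperm j k) (contract_op i j v).
Proof.
have [l ->] := contract_op_cup i j v.
rewrite !lfunZ contract_cup2 // !perm_op_cup // tpermR tpermL.
by rewrite [tperm i j k]tpermD // [tperm j k i]tpermD 1?eq_sym.
Qed.

Lemma contract_contract_perm :
  contract_op i j (contract_op j k (perm_op (tperm i j) v)) =
  contract_op i j (perm_op (tperm j k) v).
Proof.
have -> : contract_op j k (perm_op (tperm i j) v) =
    perm_op (tperm i j) (contract_op i k v).
  by rewrite perm_opJ // tpermL tpermD // eq_sym.
rewrite contract_op_perm //.
have -> : contract_op i j (perm_op (tperm j k) v) =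
    perm_op (tperm j k) (contract_op i k v).
  by rewrite perm_opJ // tpermR tpermD // eq_sym.
have [l ->] := contract_op_cup i k v.
rewrite !lfunZ perm_op_cup // tpermR [tperm j k i]tpermD 1?eq_sym //.
by rewrite -(cup_sym ik) contract_cup2 // eq_sym.
Qed.

Lemma contract_contract_contract :
  contract_op i j (contract_op j k (contract_op i j v)) = contract_op i j v.
Proof.
have [l ->] := contract_op_cup i j v.
rewrite !lfunZ contract_cup2 // -(cup_sym jk) contract_opC 1?eq_sym //.
by rewrite contract_cup2 1?eq_sym // cup_sym.
Qed.
End ThreePoints.

Lemma dot_op_on o b w : o != b -> dot_op o (arc o b w) = arc o b (X w).
Proof. by move=> ob; rewrite dot_opE // /dot_fun eqxx. Qed.

Lemma dot_op_off o a b w : a != b -> o != a -> o != b ->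
  dot_op o (arc a b w) = c *: arc a b w - arc o b w - arc o a (S w)
    + eta (S w) *: cup o a + eta w *: cup o b.
Proof.
move=> ab oa ob; rewrite dot_opE // /dot_fun.
by rewrite ![_ == o]eq_sym (negPf oa) (negPf ob).
Qed.

Lemma arc_ind1 o (P : V -> Prop) :
  P 0 -> (forall u v, P u -> P v -> P (u + v)) ->
  (forall b w, o != b -> P (arc o b w)) ->
  (forall a b w, a != b -> o != a -> o != b -> P (arc a b w)) -> forall v, P v.
Proof.
move=> P0 PD Po Pab; apply: arc_ind => // a b w ab.
case: (eqVneq o a) => [oa|oa]; first by rewrite -oa; apply: Po; rewrite oa.
case: (eqVneq o b) => [ob|ob]; last exact: Pab.
by rewrite -ob arc_sym //; exact: Po.
Qed.

Lemma arc_ind2 o p (P : V -> Prop) :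
  P 0 -> (forall u v, P u -> P v -> P (u + v)) ->
  (forall w, P (arc o p w)) ->
  (forall b w, o != b -> p != b -> P (arc o b w)) ->
  (forall b w, o != b -> p != b -> P (arc p b w)) ->
  (forall a b w, a != b -> o != a -> o != b -> p != a -> p != b -> P (arc a b w)) ->
  forall v, P v.
Proof.
move=> P0 PD Pop Po Pp Pab; apply: (@arc_ind1 o) => // [b w ob|a b w ab oa ob].
  by case: (eqVneq p b) => [<-|pb] //; exact: Po.
case: (eqVneq p a) => [pa|pa]; first by rewrite -pa; apply: Pp; rewrite // pa.
case: (eqVneq p b) => [pb|pb]; last exact: Pab.
by rewrite -pb arc_sym //; exact: Pp.
Qed.

Lemma dot_perm o g v : g o = o ->
  perm_op g (dot_op o v) = dot_op o (perm_op g v).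
Proof.
move=> go; elim/(@arc_ind1 o): v => [|u v IHu IHv|b w ob|a b w ab oa ob].
- by rewrite !lfun0.
- by rewrite !lfunD IHu IHv.
- by rewrite dot_op_on // !perm_opE // go dot_op_on // -go (inj_eq perm_inj).
rewrite dot_op_off // perm_opE // dot_op_off ?(inj_eq perm_inj) //; last first.
- by rewrite -go (inj_eq perm_inj).
- by rewrite -go (inj_eq perm_inj).
by rewrite !pair_lin !perm_opE // go.
Qed.

Lemma dot_contract o k l v : o != k -> o != l -> k != l ->
  contract_op k l (dot_op o v) = dot_op o (contract_op k l v).
Proof.
move=> ok ol kl; have okl : (o \in pred2 k l) = false.
  by rewrite !inE (negPf ok) (negPf ol).
have dot_cup : dot_op o (cup k l) = c *: cup k l.
  rewrite dot_op_off // (lab_S1 lab) (lab_eta1 lab); vring.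
elim/(@arc_ind1 o): v => [|u v IHu IHv|b w ob|a b w ab oa ob].
- by rewrite !lfun0.
- by rewrite !lfunD IHu IHv.
- rewrite dot_op_on // !contract_opE // lfunZ dot_cup /contraction okl.
  case: ifP => _; last by rewrite !scale0r.
  rewrite (lab_etaX lab); vring.
rewrite dot_op_off // !pair_lin !contract_opE //.
rewrite [dot_op o _]lfunZ dot_cup /contraction okl (lab_eta1 lab).
by case: ifP => _; case: ifP => _; vring.
Qed.

Lemma iter_dot_op o b n w : o != b ->
  iter n (dot_op o) (arc o b w) = arc o b (iter n X w).
Proof. by move=> ob; elim: n => //= n ->; rewrite dot_op_on. Qed.

Lemma contract_dot_contract o p n v : o != p ->
  contract_op o p (iter n (dot_op o) (contract_op o p v)) =
  omega n *: contract_op o p v.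
Proof.
move=> op; have [l ->] := contract_op_cup o p v.
have -> : iter n (dot_op o) (l *: cup o p) = l *: arc o p (iter n X one).
  by elim: n => //= n ->; rewrite lfunZ dot_op_on.
rewrite lfunZ contract_opE // /contraction !inE !eqxx orbT /= (lab_epsX lab).
by rewrite !scalerA mulrC.
Qed.

Section TwoPoints.
Variables o p : I.
Hypothesis op : o != p.
Local Notation s := (perm_op (tperm o p)).
Local Notation e := (contract_op o p).
Local Notation y := (dot_op o).

(** The action of y_2 when o and p are the first two points. *)
Definition next_dot v := s (y (s v)) + s v - e v.

(** Values of the transposition and of the contraction at o and p on arcs; the
    suffix tells the end points, a and b being distinct from o and p. *)
Lemma tp_op w : s (arc o p w) = arc o p (S w).
Proof. by rewrite perm_opE // tpermL tpermR arc_sym. Qed.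
Lemma tp_ob b w : o != b -> p != b -> s (arc o b w) = arc p b w.
Proof. by move=> ob pb; rewrite perm_opE // tpermL tpermD. Qed.
Lemma tp_pb b w : o != b -> p != b -> s (arc p b w) = arc o b w.
Proof. by move=> ob pb; rewrite perm_opE // tpermR tpermD. Qed.
Lemma tp_ab a b w : a != b -> o != a -> o != b -> p != a -> p != b ->
  s (arc a b w) = arc a b w.
Proof. by move=> ab oa ob pa pb; rewrite perm_opE // !tpermD. Qed.
Lemma ct_op w : e (arc o p w) = eps w *: cup o p.
Proof. by rewrite contract_opE // /contraction !inE !eqxx orbT. Qed.
Lemma ct_ob b w : o != b -> p != b -> e (arc o b w) = eta (S w) *: cup o p.
Proof.
move=> ob pb; rewrite contract_opE // /contraction !inE !eqxx.
by rewrite ![b == _]eq_sym (negPf ob) (negPf pb).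
Qed.
Lemma ct_pb b w : o != b -> p != b -> e (arc p b w) = eta (S w) *: cup o p.
Proof.
move=> ob pb; rewrite contract_opE // /contraction !inE !eqxx orbT.
by rewrite ![b == _]eq_sym (negPf ob) (negPf pb).
Qed.
Lemma ct_ab a b w : a != b -> o != a -> o != b -> p != a -> p != b ->
  e (arc a b w) = 0.
Proof.
move=> ab oa ob pa pb; rewrite contract_opE // /contraction !inE.
by rewrite ![a == _]eq_sym ![b == _]eq_sym !(negPf oa, negPf ob, negPf pa, negPf pb)
  scale0r.
Qed.

Let SX := lab_SX lab.
Let S1 := lab_S1 lab.
Let eta1 := lab_eta1 lab.
Let etaX := lab_etaX lab.
Let epsS := lab_epsS lab.

Lemma contract_next_dot v : e (y v + next_dot v) = 0.
Proof.
rewrite /next_dot !(lfunD, lfunN) !contract_op_perm //.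
have -> : e (e v) = eps one *: e v.
  have [l ->] := contract_op_cup o p v.
  by rewrite [LHS]lfunZ ct_op !scalerA mulrC.
elim/(@arc_ind2 o p): v => [|u v IHu IHv|w|b w ob pb|b w ob pb|a b w ab oa ob pa pb].
- by rewrite !lfun0; vring.
- move: IHu IHv; rewrite !lfunD => IHu IHv.
  rewrite -[RHS]addr0 -[X in _ = X + _]IHu -[X in _ = _ + X]IHv; vring.
- rewrite tp_op !dot_op_on // !ct_op -(epsS (X (S w))) SX SS.
  rewrite !pair_lin epsS; vring.
- rewrite tp_ob // dot_op_on // dot_op_off //.
  rewrite !pair_lin !(ct_op, ct_ob, ct_pb) // SX.
  rewrite !pair_lin etaX eta1 S1 epsS eta1; vring.
- rewrite tp_pb // dot_op_on // dot_op_off //.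
  rewrite !pair_lin !(ct_op, ct_ob, ct_pb) // SX.
  rewrite !pair_lin etaX eta1 S1 epsS eta1; vring.
rewrite tp_ab // dot_op_off // !pair_lin.
rewrite !ct_ob // !ct_ab // S1 eta1 SS; vring.
Qed.

Lemma next_dot_contract v : y (e v) + next_dot (e v) = 0.
Proof.
rewrite /next_dot; have [l ->] := contract_op_cup o p v.
have -> : y (l *: cup o p) = l *: arc o p (X one) by rewrite lfunZ dot_op_on.
rewrite !lfunZ tp_op S1 dot_op_on // tp_op ct_op SX S1.
rewrite !pair_lin; vring.
Qed.

(** The one relation that is not visible on diagrams.  The four cases are the
    possible positions of an arc relative to the two points; each one reduces to
    the commutation rule of [X] and [S] and to [eta (X w) = c * eta w]. *)
Lemma dot_next_dot v : y (next_dot v) = next_dot (y v).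
Proof.
rewrite /next_dot; have yop x := dot_op_on x op.
have XS w : X (S w) = - S (X w) + eps w *: one - w by rewrite SX; vring.
elim/(@arc_ind2 o p): v => [|u v IHu IHv|w|b w ob pb|b w ob pb|a b w ab oa ob pa pb].
- by rewrite !lfun0; vring.
- move: IHu IHv; rewrite !(lfunD, lfunN) => IHu IHv.
  transitivity ((y (s (y (s u))) + y (s u) - y (e u))
    + (y (s (y (s v))) + y (s v) - y (e v))).
    vring.
  rewrite IHu IHv; vring.
(* In S (X (S (X w))) it is X (S (X w)) that has to be expanded, so that S
   cancels; expanding S (X w) would leave eps (X (S w)) beside eps (X w). *)
- rewrite !(tp_op, ct_op, yop, pair_lin) [X (S (X w))]XS !(SS, S1, pair_lin).
  rewrite !(SX, pair_lin, SS, S1, epsS) /=.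
  vring.
- have tb x := tp_ob x ob pb; have tpb x := tp_pb x ob pb.
  have eb x := ct_ob x ob pb; have epb x := ct_pb x ob pb.
  have yb x := dot_op_on x ob; have ypb x := dot_op_off x pb op ob.
  rewrite !(tp_op, ct_op, yop, tb, tpb, eb, epb, yb, ypb, pair_lin).
  rewrite !(SX, pair_lin, SS, S1, epsS, etaX, eta1) /=; vring.
- have tb x := tp_ob x ob pb; have tpb x := tp_pb x ob pb.
  have eb x := ct_ob x ob pb; have epb x := ct_pb x ob pb.
  have yb x := dot_op_on x ob; have ypb x := dot_op_off x pb op ob.
  rewrite !(tp_op, ct_op, yop, tb, tpb, eb, epb, yb, ypb, pair_lin).
  rewrite !(SX, pair_lin, SS, S1, epsS, etaX, eta1) /=; vring.
have tab x := tp_ab x ab oa ob pa pb.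
have eab x := ct_ab x ab oa ob pa pb.
have yab x := dot_op_off x ab oa ob.
have tb x := tp_ob x ob pb; have tpb x := tp_pb x ob pb.
have eb x := ct_ob x ob pb; have epb x := ct_pb x ob pb.
have yb x := dot_op_on x ob; have ypb x := dot_op_off x pb op ob.
have ta x := tp_ob x oa pa; have tpa x := tp_pb x oa pa.
have ea x := ct_ob x oa pa; have epa x := ct_pb x oa pa.
have ya x := dot_op_on x oa; have ypa x := dot_op_off x pa op oa.
rewrite !(tp_op, ct_op, yop, tb, tpb, eb, epb, yb, ypb, ta, tpa, ea, epa, ya, ypa,
  tab, eab, yab, pair_lin).
rewrite !(SX, pair_lin, SS, S1, epsS, etaX, eta1) /=; vring.
Qed.

End TwoPoints.

Definition pt (i : nat) : I := inord i.

Lemma pt_neq (i j : nat) : i <> j -> (i < m.+1)%N -> (j < m.+1)%N -> pt i != pt j.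
Proof.
move=> ij im jm; apply/eqP => /(congr1 (@nat_of_ord _)).
by rewrite !inordK // => /ij.
Qed.

Definition pair_s (i : nat) := perm_op (tperm (pt i) (pt i.+1)).
Definition pair_e (i : nat) := contract_op (pt i) (pt i.+1).

Lemma perm_op_tpermK i j v : perm_op (tperm i j) (perm_op (tperm i j) v) = v.
Proof. by rewrite perm_opM tperm2 perm_op1. Qed.

Lemma pair_brauer : brauer_action omega m.+1 pair_s pair_e.
Proof.
have three (i : nat) : (i.+2 < m.+1)%N ->
    [/\ pt i != pt i.+1, pt i.+1 != pt i.+2 & pt i != pt i.+2].
  by move=> im; split; apply: pt_neq; lia.
have two (i : nat) : (i.+1 < m.+1)%N -> pt i != pt i.+1 by move=> im; apply: pt_neq; lia.
have far (i j : nat) : distant i j -> (i.+1 < m.+1)%N -> (j.+1 < m.+1)%N ->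
    [/\ pt i != pt j, pt i.+1 != pt j, pt i != pt j.+1 & pt i.+1 != pt j.+1].
  by rewrite /distant => d im jm; split; apply: pt_neq; lia.
split=> [i v _|i j v d im jm|i v im|i v im|i j v d im jm|i j v d im jm|i v im|i v im
  |i v im|i v im|i v im|i v im|i v im|i v im];
  try (have [ij jk ik] := three _ im); try (have ab := two _ im).
- exact: perm_op_tpermK.
- rewrite !perm_opM; congr (fun_of_lfun (perm_op _) _).
  have [a1 a2 a3 a4] := far _ _ d im jm.
  apply/perm.permP => a; rewrite !permM (inj_tperm _ _ _ perm_inj).
  by rewrite !(tpermD a1 a2, tpermD a3 a4).
- exact: perm_braid.
- have [l E] := contract_op_cup (pt i) (pt i.+1) v.
  by rewrite /pair_e E lfunZ contract_cup1 // !scalerA mulrC.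
- have [a1 a2 a3 a4] := far _ _ d im jm.
  by rewrite /pair_s /pair_e perm_opJ ?two // (tpermD a1 a2) (tpermD a3 a4).
- have [a1 a2 a3 a4] := far _ _ d im jm.
  have [l E] := contract_op_cup (pt i) (pt i.+1) v.
  have [l' E'] := contract_op_cup (pt j) (pt j.+1) v.
  rewrite /pair_e E E' !lfunZ !contract_cup0 ?two ?scaler0 //.
    by rewrite ![pt j == _]eq_sym ![pt j.+1 == _]eq_sym a1 a2 a3 a4.
  by rewrite a1 a2 a3 a4.
- exact: contract_op_perm.
- exact: perm_contract_op.
- exact: perm_contract_contract.
- exact: contract_contract_perm.
- rewrite /pair_s /pair_e [tperm (pt i.+1) _]tpermC [tperm (pt i) _]tpermC.
  rewrite -!(contract_opC _ jk) -!(contract_opC _ ij).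
  by apply: contract_contract_perm; rewrite eq_sym.
- rewrite /pair_s /pair_e [tperm (pt i.+1) _]tpermC [tperm (pt i) _]tpermC.
  rewrite -!(contract_opC _ jk) -!(contract_opC _ ij).
  by apply: perm_contract_contract; rewrite eq_sym.
- rewrite /pair_e -!(contract_opC _ jk) -!(contract_opC _ ij).
  by apply: contract_contract_contract; rewrite eq_sym.
exact: contract_contract_contract.
Qed.

Lemma pair_dot : (0 < m)%N ->
  first_dot_action omega m.+1 pair_s pair_e (dot_op (pt 0)).
Proof.
move=> m0; have op : pt 0 != pt 1 by apply: pt_neq.
have nextE v : jucys pair_s pair_e (dot_op (pt 0)) 1 v = next_dot (pt 0) (pt 1) v.
  by rewrite jucysS.
split=> [i v i0 im|i v i0 im|a v|v|v|v]; rewrite ?nextE.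
- apply: dot_perm; rewrite tpermD // eq_sym; apply: pt_neq; lia.
- by apply: dot_contract; apply: pt_neq; lia.
- exact: contract_dot_contract.
- exact: dot_next_dot.
- exact: contract_next_dot.
exact: next_dot_contract.
Qed.

End PairModule.

(** * Residues modulo a stable polynomial as labels *)

Section HornerOperator.
Variables (F : fieldType) (V : vectType F) (y : 'End(V)).
Implicit Types (p q : {poly F}) (v : V).

Definition horner_op p : 'End(V) :=
  polyext (fun i => iter i (comp_lfun y) \1%VF) p.
HB.instance Definition _ := GRing.Linear.copy horner_op
  (polyext (fun i => iter i (comp_lfun y) \1%VF)).

Lemma horner_opC a v : horner_op a%:P v = a *: v.
Proof. by rewrite /horner_op polyextC scale_lfunE id_lfunE. Qed.

Lemma horner_opD p q v : horner_op (p + q) v = horner_op p v + horner_op q v.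
Proof. by rewrite linearD add_lfunE. Qed.

Lemma horner_opMX p v : horner_op (p * 'X) v = y (horner_op p v).
Proof.
rewrite /horner_op polyextMX -comp_lfunE; congr (fun_of_lfun _ v).
by apply/esym/polyext_morph => // a f g; rewrite comp_lfunDr -comp_lfunZr.
Qed.

Lemma horner_opM p q v : horner_op (p * q) v = horner_op p (horner_op q v).
Proof.
elim/poly_ind: p => [|p a IH]; first by rewrite mul0r !linear0 !zero_lfunE.
rewrite mulrDl mulrAC !horner_opD !horner_opMX IH horner_opC; congr (_ + _).
by rewrite mul_polyC linearZ scale_lfunE.
Qed.

Lemma horner_opX v : horner_op 'X v = y v.
Proof. by rewrite -[X in horner_op X]mul1r horner_opMX horner_opC scale1r. Qed.

Lemma horner_op_XsubC a v : horner_op ('X - a%:P) v = y v - a *: v.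
Proof. by rewrite -polyCN horner_opD horner_opX horner_opC scaleNr. Qed.

End HornerOperator.

Section ResidueLabels.
Variables (F : fieldType) (omega : nat -> F) (m : {poly F}) (c : F).
Hypotheses (wadm : weakly_admissible omega) (m_monic : m \is monic).
Hypotheses (mA : annihilates omega m) (m_refl : m %| refl omega m).
Hypothesis (m_c : root m c).
Implicit Types p q : {poly F}.

Local Notation r := (size m).-1.
Local Notation W := 'rV[F]_r.
Local Notation refl := (refl omega).

Definition red p : W := poly_rV (p %% m).

Let m_neq0 : m != 0. Proof. exact: monic_neq0. Qed.

Lemma redK p : rVpoly (red p) = p %% m.
Proof.
rewrite poly_rV_K // -ltnS prednK ?size_poly_gt0 //.
by rewrite ltn_modp.
Qed.

Lemma rVpolyK_red (w : W) : red (rVpoly w) = w.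
Proof.
rewrite /red modp_small ?rVpolyK //.
by rewrite (leq_ltn_trans (size_poly _ _)) // prednK ?size_poly_gt0.
Qed.

Lemma red_is_linear : linear red.
Proof. by move=> a p q; rewrite /red modpD modpZl linearP. Qed.
HB.instance Definition _ := GRing.isLinear.Build F {poly F} W *:%R red red_is_linear.

Lemma red_eq p q : m %| p - q -> red p = red q.
Proof.
by rewrite /dvdp => /eqP pq; apply/eqP; rewrite -subr_eq0 -linearB /= /red pq linear0.
Qed.

Lemma red_dvd p : m %| p -> red p = 0.
Proof. by move=> mp; rewrite (@red_eq p 0) ?subr0 // linear0. Qed.

(** Modulo m, the rule for [refl (h * 'X)] loses its inhomogeneous terms on
    multiples of an annihilating m; hence stability of m itself suffices. *)
Lemma refl_dvd q : m %| q -> m %| refl q.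
Proof.
move=> /dvdpP[h ->]; elim/poly_ind: h => [|h a IH].
  by rewrite mul0r linear0 dvdp0.
rewrite mulrDl mul_polyC linearD linearZ /= mulrAC reflMX.
rewrite [h * m]mulrC mA polyC0 addr0 [m * h]mulrC.
rewrite dvdp_add // -?mul_polyC ?dvdp_mull // dvdp_sub ?dvdp_mull //.
by rewrite dvdpNr dvdp_mulr.
Qed.

Definition res_X : 'End(W) := linfun (fun w => red (rVpoly w * 'X)).
Definition res_S : 'End(W) := linfun (fun w => red (refl (rVpoly w))).
Definition res_eps (w : W) : F^o := eps omega (rVpoly w).
Definition res_eta (w : W) : F^o := (rVpoly w).[c].

Lemma res_eps_is_linear : linear res_eps.
Proof. by move=> a u w; rewrite /res_eps linearP /= epsD epsZ. Qed.
HB.instance Definition _ := GRing.isLinear.Build F W F^o *:%R res_eps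
  res_eps_is_linear.

Lemma res_eta_is_linear : linear res_eta.
Proof. by move=> a u w; rewrite /res_eta linearP /= hornerD hornerZ. Qed.
HB.instance Definition _ := GRing.isLinear.Build F W F^o *:%R res_eta
  res_eta_is_linear.

Lemma res_X_red p : res_X (red p) = red (p * 'X).
Proof.
rewrite /res_X linfunE => [|a u w]; last first.
  by rewrite linearP /= mulrDl -scalerAl linearP.
rewrite redK; apply: red_eq; rewrite -mulrBl dvdp_mulr //.
by rewrite {2}(divp_eq p m) opprD addrCA subrr addr0 dvdpNr dvdp_mull.
Qed.

Lemma res_S_red p : res_S (red p) = red (refl p).
Proof.
rewrite /res_S linfunE => [|a u w]; last by do 3!rewrite linearP /=.
rewrite redK; apply: red_eq; rewrite -linearB refl_dvd //.
by rewrite {2}(divp_eq p m) opprD addrCA subrr addr0 dvdpNr dvdp_mull.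
Qed.

Lemma res_eps_red p : res_eps (red p) = eps omega p.
Proof.
rewrite /res_eps redK {2}(divp_eq p m) epsD [_ %/ _ * _]mulrC mA.
by rewrite add0r.
Qed.

Lemma res_eta_red p : res_eta (red p) = p.[c].
Proof.
rewrite /res_eta redK {2}(divp_eq p m) hornerD hornerM.
by rewrite (eqP m_c) mulr0 add0r.
Qed.

Lemma iter_res_X n p : iter n res_X (red p) = red (p * 'X^n).
Proof. by elim: n => [|n IH]; rewrite ?mulr1 //= IH res_X_red exprSr mulrA. Qed.

Lemma residue_label :
  arc_label res_X res_S (red 1) res_eps res_eta c omega.
Proof.
have redP w : exists p, w = red p by exists (rVpoly w); rewrite rVpolyK_red.
split=> [|w|w|w||w|a].
- by rewrite res_S_red reflC.
- by have [p ->] := redP w; rewrite !res_S_red reflK.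
- have [p ->] := redP w.
  rewrite res_X_red !res_S_red res_X_red /= res_eps_red reflMX.
  by rewrite linearB linearD linearN -[(eps _ _)%:P]mulr1 mul_polyC linearZ.
- by have [p ->] := redP w; rewrite /= res_S_red !res_eps_red wadm.
- by rewrite /= res_eta_red hornerC.
- by have [p ->] := redP w; rewrite /= res_X_red !res_eta_red hornerMX mulrC.
by rewrite iter_res_X /= mul1r res_eps_red epsXn.
Qed.

Lemma horner_op_res_X p q : horner_op res_X p (red q) = red (p * q).
Proof.
elim/poly_ind: p => [|p a IH]; first by rewrite mul0r !linear0 zero_lfunE.
rewrite horner_opD horner_opMX horner_opC IH res_X_red -linearZ -linearD.
by rewrite -mul_polyC /=; congr red; ring.
Qed.

Section Cyclotomic.
Variable N : nat.
Local Notation V := (pair_space W N).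
Local Notation arc := (@arc F W res_S N).
Variable o : 'I_N.+1.
Local Notation y := (dot_op res_X res_S (red 1) res_eta c o).

Lemma horner_op_arc p b w : o != b ->
  horner_op y p (arc o b w) = arc o b (horner_op res_X p w).
Proof.
move=> ob; elim/poly_ind: p => [|p a IH].
  by rewrite !linear0 !zero_lfunE linear0.
rewrite !horner_opD !horner_opMX !horner_opC IH (dot_op_on residue_label) //.
by rewrite [in RHS]linearD /= arcZ.
Qed.

(** On an arc at o this holds because labels are residues modulo m.  For any
    other arc, y - c produces arcs at o with labels of the form p(c) - p, which
    are divisible by 'X - c, and m / ('X - c) kills those. *)
Lemma horner_op_dot (v : V) : horner_op y m v = 0.
Proof.
have lab := residue_label.
elim/(@arc_ind1 _ _ _ _ _ _ _ _ _ lab N o): v => [|u v IHu IHv|b w ob|a b w ab oa ob].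
- by rewrite lfun0.
- by rewrite lfunD IHu IHv addr0.
- rewrite horner_op_arc // -[w]rVpolyK_red horner_op_res_X.
  by rewrite red_dvd ?arc0 // dvdp_mulr.
have /factor_theorem[q defm] := m_c.
have kill w' : horner_op res_X q (res_eta w' *: red 1 - w') = 0.
  rewrite -[w']rVpolyK_red; move: (rVpoly w') => p.
  rewrite /= res_eta_red -linearZ -linearB /= horner_op_res_X.
  rewrite red_dvd // [X in X %| _]defm dvdp_mul2l; last first.
    by apply: contraTneq m_neq0 => q0; rewrite defm q0 mul0r eqxx.
  by rewrite dvdp_XsubCl rootE !hornerE subrr.
rewrite [X in horner_op _ X]defm horner_opM horner_op_XsubC (dot_op_off lab) //.
rewrite (_ : _ - _ = arc o b (res_eta w *: red 1 - w)
   + arc o a (res_eta (res_S w) *: red 1 - res_S w)); last first.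
  rewrite !(arcD, arcN, arcZ); vring.
by rewrite lfunD !horner_op_arc // !kill !arc0 addr0.
Qed.
End Cyclotomic.
End ResidueLabels.

(** * The left ideal generated by e_1 *)

Section AlgebraRelations.
Variables (F : fieldType) (n : nat) (omega : nat -> F).
Local Notation A := (freeAlg F (bmwIndex n)).
Variable rel : A -> A -> Prop.
Hypothesis rel_aff : forall x1 x2, affBMW_rel omega x1 x2 -> rel x1 x2.
Variables (i : 'I_n.-1) (j k : 'I_n).
Hypotheses (i0 : i = 0%N :> nat) (j0 : j = 0%N :> nat) (k1 : k = 1%N :> nat).

Local Notation R := (presAlg rel).
Local Notation s := (presGen rel (inl (inl i) : bmwIndex n)).
Local Notation e := (presGen rel (inl (inr i) : bmwIndex n)).
Local Notation y := (presGen rel (inr j : bmwIndex n)).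
Local Notation z := (presGen rel (inr k : bmwIndex n)).

Lemma presPiM (x1 x2 : A) : presPi rel (x1 * x2) = presPi rel x1 * presPi rel x2.
Proof. exact: presPi_M. Qed.

Lemma presPi0 : presPi rel 0 = 0.
Proof. by apply: (addrI (presPi rel 0)); rewrite -presPiD !addr0. Qed.

Lemma presPiN (x : A) : presPi rel (- x) = - presPi rel x.
Proof. by apply/eqP; rewrite -addr_eq0 -presPiD addNr presPi0. Qed.

Lemma presPiZ a (x : A) : presPi rel (a *: x) = a *: presPi rel x.
Proof. exact: presPi_Z. Qed.

Lemma presPiX a (x : A) : presPi rel (x ^+ a) = presPi rel x ^+ a.
Proof. by elim: a => [|a IH] //; rewrite !exprS presPiM IH. Qed.

Lemma gen_es : e * s = e.
Proof. by rewrite -presPiM; exact/presPi_rel/rel_aff/rel_es. Qed.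

Lemma gen_se : s * e = e.
Proof. by rewrite -presPiM; exact/presPi_rel/rel_aff/rel_se. Qed.

Lemma gen_eye a : e * y ^+ a * e = omega a *: e.
Proof.
case: a => [|a].
  by rewrite expr0 mulr1 -presPiM -presPiZ; exact/presPi_rel/rel_aff/rel_ee.
pose fe := freeGen F (inl (inr i) : bmwIndex n).
pose fy := freeGen F (inr j : bmwIndex n).
have -> : e * y ^+ a.+1 * e = presPi rel (fe * fy ^+ a.+1 * fe).
  by rewrite 2!presPiM presPiX.
by rewrite -presPiZ; apply/presPi_rel/rel_aff/rel_eye.
Qed.

Lemma gen_sy : s * y = z * s + (e - 1).
Proof.
have -> : e - 1 = s * y - z * s.
  rewrite -!presPiM -!presPiN -!presPiD; apply/esym/presPi_rel/rel_aff.
  by apply: rel_sy; rewrite i0.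
by rewrite addrC subrK.
Qed.

Lemma gen_zy : z * y = y * z.
Proof. by rewrite -!presPiM; exact/presPi_rel/rel_aff/rel_yy_comm. Qed.

Lemma gen_ze : z * e = - (y * e).
Proof.
apply/eqP; rewrite -addr_eq0 addrC -mulrDl -presPiD -presPiM.
rewrite -presPi0; apply/eqP/presPi_rel/rel_aff.
by apply: rel_yye; rewrite i0.
Qed.

(** The element p(y_1) e_1. *)
Definition cyclic_vec (p : {poly F}) : R := polyext (fun a => y ^+ a * e) p.
HB.instance Definition _ := GRing.Linear.copy cyclic_vec
  (polyext (fun a => y ^+ a * e)).

Lemma presAlg_mull_lin (x : R) : linear (GRing.mul x).
Proof. by move=> a u v; rewrite mulrDr presAlg_scalerAr. Qed.

Lemma cyclic_vecMX p : cyclic_vec (p * 'X) = y * cyclic_vec p.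
Proof.
rewrite /cyclic_vec polyextMX; apply/esym/polyext_morph => [|a].
  exact: presAlg_mull_lin.
by rewrite exprS mulrA.
Qed.

Lemma cyclic_vecC a : cyclic_vec a%:P = a *: e.
Proof. by rewrite /cyclic_vec polyextC mul1r. Qed.

Lemma e_cyclic_vec p : e * cyclic_vec p = eps omega p *: e.
Proof.
rewrite /cyclic_vec polyext_comp; last exact: presAlg_mull_lin.
rewrite /eps /polyext scaler_suml; apply: eq_bigr => a _.
by rewrite mulrA gen_eye scalerA.
Qed.

Lemma z_cyclic_vec p : z * cyclic_vec p = - (y * cyclic_vec p).
Proof.
elim/poly_ind: p => [|p a IH]; first by rewrite linear0 !mulr0 oppr0.
rewrite linearD /= cyclic_vecMX cyclic_vecC !mulrDr mulrA gen_zy -mulrA IH.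
by rewrite mulrN -!presAlg_scalerAr gen_ze scalerN opprD.
Qed.

Lemma s_cyclic_vec p : s * cyclic_vec p = cyclic_vec (refl omega p).
Proof.
elim/poly_ind: p => [|p a IH]; first by rewrite !linear0 mulr0.
rewrite !linearD /= reflMX reflC !linearD !linearN /= !cyclic_vecMX !cyclic_vecC.
rewrite mulrDr mulrA gen_sy mulrDl -mulrA IH z_cyclic_vec mulrBl mul1r.
by rewrite e_cyclic_vec -presAlg_scalerAr gen_se addrA.
Qed.

(** Compare e_1 s_1 p(y_1) e_1 with e_1 p(y_1) e_1. *)
Lemma e_neq0_weakly_admissible : e <> 0 -> weakly_admissible omega.
Proof.
move=> e0 p; apply/eqP; rewrite -subr_eq0; apply/negP => /negP d0.
apply: e0; rewrite -[e]scale1r -(mulVf d0) -scalerA scalerBl.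
by rewrite -!e_cyclic_vec -s_cyclic_vec mulrA gen_es subrr scaler0.
Qed.

Lemma prod_cyclic_vec (l : seq F) p :
  presPi rel (\prod_(x <- l) (freeGen F (inr j : bmwIndex n) - x%:A)) * cyclic_vec p
  = cyclic_vec (\prod_(x <- l) ('X - x%:P) * p).
Proof.
elim: l => [|x l IH]; first by rewrite !big_nil !mul1r.
rewrite !big_cons presPiM -mulrA IH presPiD presPiN presPiZ mulrBl.
rewrite -presAlg_scalerAl mul1r -mulrA mulrBl linearB /=.
by rewrite ['X * _]mulrC cyclic_vecMX mul_polyC [cyclic_vec (x *: _)]linearZ.
Qed.
End AlgebraRelations.

Section Admissible.
Variables (F : fieldType) (omega : nat -> F) (r : nat) (u : r.-tuple F).
Hypotheses (r_gt0 : (0 < r)%N) (adm : admissible omega u).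
Local Notation m := (\prod_(x <- u) ('X - x%:P)).
Local Notation P := (@cyclic_vec F 2 (cycBMW_rel omega u) ord0 ord0).

Let sub_rel := @rel_aff 2 F omega r u.

Lemma cyc2_e1_neq0 : cyc2_e1 omega u <> 0.
Proof.
move=> e0; have := adm (c := fun _ => 1).
rewrite big1 => [/(_ erefl (Ordinal r_gt0))|i _].
  by move/eqP; rewrite oner_eq0.
by rewrite e0 mulr0 scaler0.
Qed.

Lemma cyclic_vec_m p : P (m * p) = 0.
Proof.
rewrite -prod_cyclic_vec (_ : presPi _ _ = 0) ?mul0r // -presPi0.
by rewrite big_tuple; apply/presPi_rel/rel_cyc.
Qed.

Lemma admissible_annihilates : annihilates omega m.
Proof.
move=> p; apply/eqP/negP => /negP d0; apply: cyc2_e1_neq0.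
rewrite -[LHS]scale1r -(mulVf d0) -scalerA.
rewrite -(@e_cyclic_vec F 2 omega _ sub_rel ord0 ord0 erefl erefl).
by rewrite cyclic_vec_m mulr0 scaler0.
Qed.

(** Applying s_1 to m(y_1) e_1 = 0 shows that refl m kills e_1; so does its
    difference with + m or - m, whose degree is less than r, and which is
    therefore zero by linear independence. *)
Lemma admissible_refl : m %| refl omega m.
Proof.
have szm : size m = r.+1 by rewrite size_prod_XsubC size_tuple.
pose d := refl omega m - (-1) ^+ r *: m.
have szd : (size d <= r)%N.
  apply/leq_sizeP => a; rewrite leq_eqVlt => /orP[/eqP <-|ra].
    by rewrite /d coefB coefZ coef_refl ?szm // subrr.
  rewrite /d coefB coefZ !nth_default ?mulr0 ?subr0 ?szm //.
  by rewrite (leq_trans (size_refl _ _)) ?szm.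
have Pm0 : P m = 0 by rewrite -[m]mulr1 cyclic_vec_m.
have Pd : P d = 0.
  rewrite linearB linearZ /= Pm0 scaler0 subr0.
  rewrite -(@s_cyclic_vec F 2 omega _ sub_rel ord0 ord0 ord_max erefl erefl erefl).
  by rewrite Pm0 mulr0.
have d0 : d = 0.
  apply/polyP => a; rewrite coef0; case: (ltnP a r) => [ar|ra]; last first.
    by rewrite nth_default // (leq_trans szd).
  apply: (adm (c := fun a : 'I_r => d`_a) _ (Ordinal ar)).
  by move: Pd; rewrite /cyclic_vec (polyextEw _ szd).
by move/eqP: d0; rewrite subr_eq0 => /eqP ->; rewrite dvdpZr ?signr_eq0.
Qed.
End Admissible.

(** * Annihilators, recursions and rational functions *)

Section Recursion.
Variables (F : fieldType) (omega : nat -> F).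
Implicit Types p q : {poly F}.

Lemma polyextMXn (V : lmodType F) (f : nat -> V) p l :
  polyext f (p * 'X^l) = polyext (fun i => f (i + l)%N) p.
Proof.
elim: l f => [|l IH] f.
  by rewrite mulr1; apply: eq_polyext => i; rewrite addn0.
by rewrite exprSr mulrA polyextMX IH; apply: eq_polyext => i; rewrite addnS.
Qed.

Lemma eps_MXn q l n : (size q <= n)%N ->
  eps omega (q * 'X^l) = \sum_(i < n) q`_i * omega (i + l)%N.
Proof. by move=> sq; rewrite /eps polyextMXn (polyextEw _ sq). Qed.

Lemma annihilatesP q : (forall l, eps omega (q * 'X^l) = 0) -> annihilates omega q.
Proof.
move=> qA h; elim/poly_ind: h q qA => [|h a IH] q qA.
  by rewrite mulr0; exact: (linear0 (eps omega)).
rewrite mulrDr epsD mulrA mulrAC IH => [|l]; last by rewrite -mulrA -exprS.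
by rewrite add0r mulrC mul_polyC epsZ -[q]mulr1 -(expr0 'X) qA mulr0.
Qed.

(** The factor 'X ensures a positive order. *)
Lemma annihilator_recursion q : q != 0 -> annihilates omega q ->
  exists (r : nat) (a : 'I_r -> F), (0 < r)%N /\
    forall l : nat, omega (r + l)%N + \sum_(j < r) a j * omega (j + l)%N = 0.
Proof.
move=> q0 qA; have lc0 : lead_coef q != 0 by rewrite lead_coef_eq0.
exists (size q), (fun j => (lead_coef q)^-1 * (q * 'X)`_j).
split=> [|l]; first by rewrite size_poly_gt0.
have sqX : (size (q * 'X)%R <= (size q).+1)%N by rewrite size_mulX.
have top : (q * 'X)`_(size q) = lead_coef q.
  by rewrite -(lead_coefMX q) lead_coefE size_mulX.
have := qA ('X * 'X^l); rewrite mulrA (eps_MXn l sqX) big_ord_recr /= top => E.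
apply: (mulfI lc0); rewrite mulr0 -[RHS]E mulrDr addrC mulr_sumr; congr (_ + _).
by apply: eq_bigr => i _; rewrite !mulrA mulfV ?mul1r.
Qed.

Lemma recursion_annihilator (r : nat) (a : 'I_r -> F) :
  (forall l : nat, omega (r + l)%N + \sum_(j < r) a j * omega (j + l)%N = 0) ->
  exists2 q : {poly F}, q != 0 & annihilates omega q.
Proof.
move=> rec; exists ('X^r + \sum_(j < r) a j *: 'X^j).
  apply/eqP => /(congr1 (fun p : {poly F} => p`_r)).
  rewrite coefD coefXn eqxx coef_sum coef0 big1 => [|j _].
    by move/eqP; rewrite addr0 oner_eq0.
  by rewrite coefZ coefXn gtn_eqF ?mulr0.
apply: annihilatesP => l; rewrite mulrDl epsD -exprD epsXn mulr_suml.
rewrite (big_morph (eps omega) (@epsD _ _) (linear0 (eps omega))).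
rewrite -[RHS](rec l); congr (_ + _); apply: eq_bigr => j _.
by rewrite -scalerAl epsZ -exprD epsXn.
Qed.
End Recursion.

Section Rationality.
Variable F : fieldType.
Implicit Types (p q : {poly F}) (f g : fps F).

(** The power series t^-d p(t) in t^-1, for p of degree at most d. *)
Definition fps_rev d p : fps F := Fps (fun k => if (k <= d)%N then p`_(d - k) else 0).

Lemma fps_coefD k : {morph (fun f => fps_coef f k) : f g / f + g}.
Proof. by []. Qed.

Lemma fps_coefC_mul a f k : fps_coef (fpsC a * f) k = a * fps_coef f k.
Proof.
by rewrite /= big_ord_recl /= subn0 big1 ?addr0 // => i _; rewrite mul0r.
Qed.

Lemma fps_revE d p : fps_rev d p = \sum_(i < d.+1) fpsC p`_i * fps_tinv F ^+ (d - i).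
Proof.
apply/fpsP => k; rewrite [LHS]/=.
rewrite (big_morph (fun g => fps_coef g k) (fps_coefD k) (erefl _)).
rewrite (eq_bigr (fun i : 'I_d.+1 => p`_i * (k == d - i)%N%:R)) => [|i _]; last first.
  by rewrite fps_coefC_mul fps_tinvXE.
case: leqP => kd; last first.
  by rewrite big1 // => i _; rewrite gtn_eqF ?mulr0 // (leq_ltn_trans (leq_subr _ _)).
have dk : (d - k < d.+1)%N by rewrite ltnS leq_subr.
rewrite (bigD1 (Ordinal dk)) //= subKn // eqxx mulr1 big1 ?addr0 // => i.
rewrite -val_eqE /= => ne; case: eqP => [E|]; last by rewrite mulr0.
by case/eqP: ne; rewrite E subKn // -ltnS.
Qed.

Lemma laurent_poly_rev d p : (size p <= d.+1)%N ->
  laurent_poly p * FracField.tofrac (fps_tinv F) ^+ d = FracField.tofrac (fps_rev d p).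
Proof.
move=> sp; have t0 : FracField.tofrac (fps_tinv F) != 0 :> laurent F.
  by rewrite tofrac_eq0 fps_tinv_neq0.
rewrite fps_revE /laurent_poly (@horner_coef_wide _ d.+1) ?size_map_poly //.
rewrite mulr_suml rmorph_sum /=; apply: eq_bigr => i _.
rewrite coef_map /= rmorphM rmorphXn /= -mulrA; congr (_ * _).
have /subnK {2}<- : (i <= d)%N by rewrite -ltnS.
rewrite /laurent_t exprVn exprD mulrCA.
by rewrite mulVf ?mulr1 // expf_neq0.
Qed.

Lemma fps_coef_rev (omega : nat -> F) d q l : (size q <= d.+1)%N ->
  fps_coef (Fps omega * fps_rev d q) (d + l) = eps omega (q * 'X^l).
Proof.
move=> sq; rewrite /eps (@polyextEw _ _ (d + l).+1); last first.
  have [->|q0] := eqVneq q 0; first by rewrite mul0r size_poly0.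
  by rewrite size_mulXn // addnC -addSn leq_add2r.
apply: eq_bigr => i _ /=; rewrite coefMXn [RHS]mulrC; congr (_ * _).
have id : (i <= d + l)%N by rewrite -ltnS.
case: ltnP => il; [rewrite ifF //; lia|rewrite ifT; last by lia].
by congr (q`_ _); lia.
Qed.

(** If the series is p / q, then q times it has no term in t^-l for l > 0;
    the factor 'X shifts this to l >= 0. *)
Lemma rational_annihilator (omega : nat -> F) : is_rational (Fps omega) ->
  exists2 q : {poly F}, q != 0 & annihilates omega q.
Proof.
case=> x; rewrite /laurent_rat; set p := \n_(repr x); set q := \d_(repr x).
have q0 : q != 0 by exact: denom_ratioP.
move/(canRL (mulfVK _)); rewrite laurent_poly_eq0 q0 => /(_ isT) pfq.
(* multiplying by t^-d puts both polynomials in the ring of power series *)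
pose d := maxn (size p) (size q).
have sp : (size p <= d.+1)%N by rewrite ltnW // ltnS leq_maxl.
have sq : (size q <= d.+1)%N by rewrite ltnW // ltnS leq_maxr.
have := congr1 ( *%R^~ (FracField.tofrac (fps_tinv F) ^+ d)) pfq.
rewrite /= -mulrA !laurent_poly_rev // -rmorphM => /eqP.
rewrite tofrac_eq => /eqP E.
exists (q * 'X); first by rewrite mulf_neq0 ?polyX_eq0.
apply: annihilatesP => l; rewrite -mulrA -exprS -(fps_coef_rev _ _ sq) -E /=.
by rewrite addnS ifF // leqNgt ltnS leq_addr.
Qed.

Lemma annihilator_rational (omega : nat -> F) q : q != 0 -> annihilates omega q ->
  is_rational (Fps omega).
Proof.
move=> q0 qA; pose d := size q.
have sq : (size q <= d.+1)%N by [].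
pose p := \poly_(j < d.+1) fps_coef (Fps omega * fps_rev d q) (d - j).
have pE : fps_rev d p = Fps omega * fps_rev d q.
  apply/fpsP => k; rewrite [LHS]/=; case: leqP => kd.
    by rewrite coef_poly ltnS leq_subr subKn.
  by rewrite -(subnKC (ltnW kd)) fps_coef_rev // qA.
exists (FracField.tofrac p / FracField.tofrac q); rewrite laurent_rat_frac //.
apply: (canLR (mulfK _)); first by rewrite laurent_poly_eq0.
have t0 : FracField.tofrac (fps_tinv F) ^+ d != 0 :> laurent F.
  by rewrite expf_neq0 // tofrac_eq0 fps_tinv_neq0.
apply: (mulIf t0); rewrite -mulrA !laurent_poly_rev ?pE ?rmorphM //.
exact: size_poly.
Qed.
End Rationality.

(** * Representations attached to a stable split polynomial *)

Section StableSplitPolynomial.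
Variables (F : fieldType) (omega : nat -> F) (r : nat) (u : r.-tuple F) (c : F).
Local Notation m := (\prod_(x <- u) ('X - x%:P)).
Hypotheses (wadm : weakly_admissible omega) (mA : annihilates omega m).
Hypotheses (m_refl : m %| refl omega m) (m_c : root m c).

Let m_monic : m \is monic. Proof. exact: monic_prod_XsubC. Qed.
Let lab := residue_label wadm m_monic mA m_refl m_c.
Local Notation W := 'rV[F]_(size m).-1.
Local Notation one := (red m 1).

Section Action.
Variable N : nat.
Hypothesis N_gt1 : (1 < N)%N.
Local Notation V := (pair_space W N).
Local Notation pt := (@pt N).
Local Notation s := (@pair_s F W (res_S omega m) N).
Local Notation e := (@pair_e F W (res_S omega m) one (@res_eps F omega m) (@res_eta F m c) N).
Local Notation y := (dot_op (res_X m) (res_S omega m) one (@res_eta F m c) c (pt 0)).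
Local Notation arc := (@arc F W (res_S omega m) N).

Lemma pt01 : pt 0 != pt 1. Proof. by apply: pt_neq; lia. Qed.

(** No closed loop arises, hence no factor omega 0. *)
Lemma pair_e_cup : e 0%N (arc (pt 2) (pt 1) one) = arc (pt 0) (pt 1) one.
Proof.
have p12 : pt 2 != pt 1 by apply: pt_neq; lia.
have p02 : pt 2 != pt 0 by apply: pt_neq; lia.
rewrite /pair_e -(contract_opC lab _ pt01) (contract_cup2 lab p12 _ p02).
  by rewrite (cup_sym lab pt01).
by rewrite eq_sym pt01.
Qed.

Lemma iter_dot_cup a : iter a y (arc (pt 0) (pt 1) one) = arc (pt 0) (pt 1) (red m 'X^a).
Proof.
by rewrite (iter_dot_op lab) ?pt01 // (iter_res_X m_monic) mul1r.
Qed.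

Lemma arc01_inj w : arc (pt 0) (pt 1) w = 0 -> w = 0.
Proof.
have lt01 : (pt 0 < pt 1)%N by rewrite !inordK ?ltnS // ltnW.
move=> /ffunP /(_ (Sub (pt 0, pt 1) lt01)); rewrite !ffunE /=.
by rewrite eqxx.
Qed.
Variable n : nat.
Hypothesis nN : (n <= N.+1)%N.

Definition pair_gen : bmwIndex n -> 'End(V) := bmw_gen (n := n) s e y.

Let bra : brauer_action omega N.+1 s e := pair_brauer lab N.
Let dot : first_dot_action omega N.+1 s e y := pair_dot lab (ltnW N_gt1).

Lemma pair_gen_aff x1 x2 :
  affBMW_rel omega x1 x2 -> free_op pair_gen x1 = free_op pair_gen x2.
Proof. exact: (affBMW_rel_op bra dot nN). Qed.

Lemma pair_gen_cyc x1 x2 :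
  cycBMW_rel omega u x1 x2 -> free_op pair_gen x1 = free_op pair_gen x2.
Proof.
case=> [|j j0]; first exact: pair_gen_aff.
pose fy := freeGen F (inr j : bmwIndex n).
apply/lfunP => v; rewrite -(big_tuple _ _ u xpredT (fun x => fy - x%:A)).
rewrite free_op0 zero_lfunE.
suff prodE (l : seq F) w : free_op pair_gen (\prod_(x <- l) (fy - x%:A)) w =
    horner_op y (\prod_(x <- l) ('X - x%:P)) w.
  by rewrite prodE (horner_op_dot wadm m_monic mA m_refl m_c).
elim: l w => [|x l IH] w.
  by rewrite !big_nil free_op1 id_lfunE horner_opC scale1r.
rewrite !big_cons free_opM comp_lfunE free_op_subE free_op_gen.
rewrite free_opZ scale_lfunE free_op1 id_lfunE IH horner_opM horner_op_XsubC.
by rewrite /= j0.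
Qed.

End Action.

Lemma stable_admissible : admissible omega u.
Proof.
move=> a sum0 i; have N_gt1 : (1 < 2)%N by [].
have rel_op := @pair_gen_cyc 2 N_gt1 2 isT.
pose V := pair_space W 2.
pose act : cycBMW 2 omega u -> V -> V := @pres_act _ _ _ (@pair_gen 2 2) _.
have actP : is_module act := pres_act_module rel_op.
pose v : V := arc (res_S omega m) (pt 2 2) (pt 2 1) one.
have act_e w : act (cyc2_e1 omega u) w = @pair_gen 2 2 (inl (inr (ord0 : 'I_1))) w.
  exact: (pres_act_gen rel_op).
have act_y w : act (cyc2_y1 omega u) w = @pair_gen 2 2 (inr (ord0 : 'I_2)) w.
  exact: (pres_act_gen rel_op).
have act_term (k : 'I_r) : act (cyc2_y1 omega u ^+ k * cyc2_e1 omega u) v =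
    arc (res_S omega m) (pt 2 0) (pt 2 1) (red m 'X^k).
  rewrite -(iter_dot_cup N_gt1) (act_mul actP) act_e /= (pair_e_cup N_gt1).
  elim: (nat_of_ord k) => [|l IH]; first by rewrite expr0 (act_one actP).
  by rewrite exprS (act_mul actP) IH act_y.
pose p := \sum_(k < r) a k *: 'X^k.
have szm : size m = r.+1 by rewrite size_prod_XsubC size_tuple.
have p_lt : (size p < size m)%N.
  rewrite szm ltnS; apply/leq_sizeP => j rj; rewrite coef_sum big1 // => k _.
  by rewrite coefZ coefXn gtn_eqF ?mulr0 // (leq_trans (ltn_ord k)).
have red_p : red m p = 0.
  apply: (arc01_inj N_gt1).
  pose h q := arc (res_S omega m) (pt 2 0) (pt 2 1) (red m q).
  have h_lin : linear h by move=> x q1 q2; rewrite /h linearP /= arcD arcZ.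
  have -> : arc (res_S omega m) (pt 2 0) (pt 2 1) (red m p) = \sum_k a k *: h 'X^k.
    exact: (linear_sumZ a _ h_lin).
  transitivity (\sum_k a k *: act (cyc2_y1 omega u ^+ k * cyc2_e1 omega u) v).
    by apply: eq_bigr => k _; rewrite act_term.
  rewrite -(linear_sumZ _ _ (act_linear_l actP v)) sum0.
  exact: (linear_zero (act_linear_l actP v)).
have p0 : p = 0.
  by have := redK m_monic p; rewrite red_p linear0 modp_small.
have := congr1 (fun q : {poly F} => q`_i) p0.
rewrite coef_sum coef0 (bigD1 i) //= coefZ coefXn eqxx mulr1 big1 ?addr0 // => k ki.
by rewrite coefZ coefXn eq_sym val_eqE (negPf ki) mulr0.
Qed.

Lemma stable_module n (n_ge2 : (1 < n)%N) :
  exists (V : vectType F) (act : affBMW n omega -> V -> V),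
    is_module act /\ exists v : V, act (aff_e1 n_ge2 omega) v <> 0.
Proof.
have rel_op := @pair_gen_aff n n_ge2 n (leqnSn n).
exists (pair_space W n), (@pres_act _ _ _ (@pair_gen n n) _).
split; first exact: pres_act_module rel_op.
exists (arc (res_S omega m) (pt n 2) (pt n 1) one).
rewrite (pres_act_gen rel_op) /= pair_e_cup // => /(arc01_inj n_ge2) one0.
have := lab_eta1 lab; rewrite one0 form0 => /eqP.
by rewrite eq_sym oner_eq0.
Qed.
End StableSplitPolynomial.

(** * The equivalence *)

Lemma finite_module_annihilator (F : fieldType) (n : nat) (n_gt1 : (1 < n)%N)
  (omega : nat -> F) (V : vectType F) (act : affBMW n omega -> V -> V) (v : V) :
  is_module act -> act (aff_e1 n_gt1 omega) v <> 0 ->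
  exists2 q : {poly F}, q != 0 & annihilates omega q.
Proof.
move=> actP; set e := aff_e1 n_gt1 omega; set w := act e v => w_neq0.
pose y : affBMW n omega := presGen _ (inr (Ordinal (ltnW n_gt1)) : bmwIndex n).
have eyw a : act e (act (y ^+ a) w) = omega a *: w.
  rewrite /w -!(act_mul actP).
  rewrite (@gen_eye F n omega _ (fun _ _ h => h) (idx1 n_gt1)
    (Ordinal (ltnW n_gt1)) erefl erefl a).
  exact: (linear_scale _ _ (act_linear_l actP v)).
pose d := (\dim {: V}).+1.
pose f : {linear {poly F} -> V} := polyext (fun i => act (y ^+ i) w).
pose g : 'Hom('rV[F]_d, V) := linfun (f \o rVpoly).
(* g cannot be injective, since d exceeds the dimension of V. *)
have : lker g != 0%VS.
  apply/negP => /eqP ker0; have := limg_ker_dim g fullv.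
  rewrite ker0 capv0 dimv0 add0n dimvf /dim /= mul1n => dimE.
  by have := dimvS (subvf (limg g)); rewrite dimE ltnn.
rewrite -vpick0; set u := vpick _ => u_neq0.
have gu : g u = 0 by apply/eqP; rewrite -memv_ker memv_pick.
exists (rVpoly u).
  by apply: contraNneq u_neq0 => u0; rewrite -(rVpolyK u) u0 linear0.
apply: annihilatesP => l; apply/eqP/negP => /negP c0; apply: w_neq0.
suff /eqP : eps omega (rVpoly u * 'X^l) *: w = 0.
  by rewrite scaler_eq0 (negPf c0) => /eqP.
rewrite lfunE /= in gu.
have -> : eps omega (rVpoly u * 'X^l) *: w = act (e * y ^+ l) (f (rVpoly u)).
  rewrite (eps_MXn omega l (leqnn _)) scaler_suml.
  rewrite (polyext_comp _ _ (act_linear_r actP _)).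
  apply: eq_bigr => i _; rewrite -(act_mul actP) -mulrA -exprD addnC.
  by rewrite (act_mul actP) eyw scalerA.
by rewrite (gu : f (rVpoly u) = 0) linear_zero //; exact: (act_linear_r actP).
Qed.

Theorem theorem7p1 (n : nat) (n_ge2 : (2 <= n)%N) (F : closedFieldType)
  (omega : nat -> F) (e1_neq0 : aff_e1 n_ge2 omega <> 0) :
  [<->
    is_rational (Fps omega);
    exists (r : nat) (N : nat) (a : 'I_r -> F), (0 < r)%N /\
      forall l : nat, (N <= l)%N ->
        omega (r + l)%N + \sum_(j < r) a j * omega (j + l)%N = 0;
    exists (r : nat) (a : 'I_r -> F), (0 < r)%N /\
      forall l : nat,
        omega (r + l)%N + \sum_(j < r) a j * omega (j + l)%N = 0;
    exists (r : nat) (u : r.-tuple F), (0 < r)%N /\ admissible omega u;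
    exists (V : vectType F) (act : affBMW n omega -> V -> V),
      is_module act /\ exists v : V, act (aff_e1 n_ge2 omega) v <> 0].
Proof.
have wadm : weakly_admissible omega.
  exact: (@e_neq0_weakly_admissible F n omega _ (fun _ _ h => h) (idx1 n_ge2)
    (Ordinal (ltnW n_ge2)) (Ordinal n_ge2) erefl erefl erefl e1_neq0).
tfae.
- move=> /rational_annihilator[q q0 qA].
  have [r [a [r0 rec]]] := annihilator_recursion q0 qA.
  by exists r, 0%N, a.
- move=> [r [N [a [r0 rec]]]].
  exists (N + r)%N, (fun j => if split j is inr j' then a j' else 0).
  split=> [|l]; first by rewrite addn_gt0 r0 orbT.
  rewrite big_split_ord /= big1 => [|j _]; last first.
    by rewrite -[lshift _ _]/(unsplit (inl j)) unsplitK mul0r.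
  rewrite add0r -[RHS](rec (N + l)%N (leq_addr _ _)) [(N + r)%N]addnC -addnA.
  congr (_ + _); apply: eq_bigr => j _.
  by rewrite -[rshift _ _]/(unsplit (inr j)) unsplitK /= [(N + j)%N]addnC -addnA.
- move=> [r [a [_ /recursion_annihilator[q q0 qA]]]].
  have [m [m_monic mA m_refl m0]] := refl_stable_annihilator wadm q0 qA.
  have [u defm] := closed_field_poly_normal m.
  rewrite (monicP m_monic) scale1r in defm.
  exists (size u), (in_tuple u); split.
    by move: m0; rewrite defm; case: (u) => //; rewrite big_nil rootE hornerC oner_eq0.
  by apply: (@stable_admissible _ _ _ _ 0) => //=; rewrite -defm.
- move=> [r [u [r0 adm]]].
  have mA := admissible_annihilates r0 adm.
  have m_refl := admissible_refl adm.
  have m_c : root (\prod_(x <- u) ('X - x%:P)) (tnth u (Ordinal r0)).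
    by rewrite root_prod_XsubC mem_tnth.
  exact: (stable_module wadm mA m_refl m_c).
move=> [V [act [actP [v ev]]]].
have [q q0 qA] := finite_module_annihilator actP ev.
exact: annihilator_rational q0 qA.
Qed.
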